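(* The Mathieu groups $M_{20}$ and $M_{21}=\mathbf{PSL}(3,4)$ are of type B. That is, for $G=M_{20}$ and for $G=M_{21}$, for every $g\in G$ with conjugacy class $\mathcal{C}$ and every irreducible representation $\rho$ of the centralizer $C_G(g)$ over $k$, the Nichols algebra $\mathfrak{B}(\mathcal{C},\rho)$ is infinite dimensional.
   Context: $k$ is an algebraically closed field of characteristic zero. Let $G$ be a finite group, $g\in G$, $\mathcal{C}=\{xgx^{-1}:x\in G\}$ its conjugacy class, $C_G(g)$ the centralizer of $g$, and $\rho:C_G(g)\to \mathbf{GL}(V)$ an irreducible (finite-dimensional) representation over $k$. The associated Yetter-Drinfeld module is $M(\mathcal{C},\rho)=kG\otimes_{kC_G(g)}V$, with $G$ acting by left multiplication on the first factor and with coaction $x\otimes v\mapsto xgx^{-1}\otimes(x\otimes v)$ for $x\in G$, $v\in V$. It is a braided vector space with braiding $c\big((x\otimes v)\otimes(y\otimes w)\big)=\big(xgx^{-1}y\otimes w\big)\otimes(x\otimes v)$. $\mathfrak{B}(\mathcal{C},\rho)$ denotes the Nichols algebra of this braided vector space, i.e. the quotient of the tensor algebra of $M(\mathcal{C},\rho)$ by the direct sum over $n\geq 2$ of the kernels of the quantum symmetrizers of degree $n$. Definition (type B). The conjugacy class $\mathcal{C}$ of $g$ in $G$ is of type B if for every irreducible representation $\rho$ of $C_G(g)$ the Nichols algebra $\mathfrak{B}(\mathcal{C},\rho)$ is infinite dimensional. The group $G$ is of type B if all its conjugacy classes are of type B. $M_{21}=\mathbf{PSL}(3,4)=\mathbf{PSL}(3,\mathbb{F}_4)$,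 acting on the $21$ points of the projective plane over $\mathbb{F}_4$; $M_{20}$ is the stabilizer of a point in this action, a (non-simple) group of order $960$ isomorphic to a semidirect product $2^4:\mathbb{A}_5$. *)

(* Defs.v *)
From HB Require Import structures.
From mathcomp Require Import all_boot all_order all_fingroup all_algebra.
From mathcomp Require Import all_solvable all_field all_character.
From mathcomp Require Import finmap zify.
From mathcomp Require Import monalg.

Set Implicit Arguments.
Unset Strict Implicit.
Unset Printing Implicit Defensive.

Import GRing.Theory.
Local Open Scope ring_scope.

(* Reduced words in the symmetric group 'S_n.  The letter a stands for the    *)
(* transposition of a and a.+1.                                               *)

Definition inversions n (s : 'S_n) : {set 'I_n * 'I_n} :=
  [set p : 'I_n * 'I_n | (p.1 < p.2)%N && (s p.2 < s p.1)%N].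

Fixpoint reduced_word_rec n (m : nat) (s : 'S_n) : seq nat :=
  if m is m'.+1 then
    if [pick p : 'I_n * 'I_n |
          (p.2 == p.1.+1 :> nat) && (s p.2 < s p.1)%N] is Some p
    then val p.1 :: reduced_word_rec m' (tperm p.1 p.2 * s)%g
    else [::]
  else [::].

Definition reduced_word n (s : 'S_n) : seq nat :=
  reduced_word_rec #|inversions s| s.

Lemma inversions_tperm n (s : 'S_n) (a b : 'I_n) :
  b = a.+1 :> nat -> (s b < s a)%N ->
  #|inversions s| = #|inversions (tperm a b * s)|.+1.
Proof.
move=> ab sba; set t := tperm a b.
pose f (p : 'I_n * 'I_n) := (t p.1, t p.2).
have f_inj : injective f by move=> [i j] [i' j'] [/perm_inj-> /perm_inj->].
have inv_ab : (a, b) \in inversions s by rewrite inE /= ab leqnn.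
have t_lt (i j : 'I_n) : (i < j)%N -> (i, j) != (a, b) -> (t i < t j)%N.
  move=> ij; rewrite xpair_eqE negb_and /t => ne.
  case: tpermP => [? | ? | /eqP ia /eqP ib];
    case: tpermP => [? | ? | /eqP ja /eqP jb]; subst;
    rewrite ?eqxx ?ltnn // in ij ne *.
  - by move: jb; rewrite -val_eqE /=; lia.
  - lia.
  - by move: ja; rewrite -val_eqE /=; lia.
  - lia.
  by move: ia; rewrite -val_eqE /=; lia.
rewrite (cardsD1 (a, b)) inv_ab add1n; congr _.+1.
rewrite -(card_imset _ f_inj); apply: eq_card => -[i j].
apply/imsetP/idP => [[[i' j']] | ].
  rewrite !inE /= => /and3P[ne lt inv] [-> ->] /=.
  by rewrite !permM !tpermK inv andbT; apply: t_lt.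
rewrite inE /= !permM => /andP[lt inv]; exists (t i, t j); last first.
  by rewrite /f /= !tpermK.
have ne : (i, j) != (a, b).
  apply: contraTneq inv => -[-> ->].
  by rewrite tpermL tpermR -leqNgt ltnW.
rewrite !inE /= inv (t_lt _ _ lt ne) !andbT.
apply: contraTneq lt => -[ti tj].
by rewrite -(tpermK a b i) -(tpermK a b j) -/t ti tj tpermL tpermR; lia.
Qed.

Definition adj_perm n (a : nat) : 'S_n :=
  if (insub a : option 'I_n, insub a.+1 : option 'I_n) is (Some i, Some j)
  then tperm i j else 1%g.

Lemma no_descent_inversions n (s : 'S_n) :
  (forall p : 'I_n * 'I_n,
     (p.2 == p.1.+1 :> nat) && (s p.2 < s p.1)%N = false) ->
  inversions s = set0.
Proof.
move=> nd; apply/setP=> -[i j]; rewrite !inE /=; apply/negP => /andP[ij].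
apply/negP; rewrite -leqNgt.
have [m def_j] : exists m, (j : nat) = (i + m)%N by exists (j - i)%N; lia.
elim: m j def_j {ij} => [|m IH] j def_j.
  by rewrite (_ : i = j) //; apply: val_inj; rewrite /= def_j addn0.
have lt_im : (i + m < n)%N by have := ltn_ord j; lia.
apply: leq_trans (IH (Ordinal lt_im) erefl) _.
have /= := nd (Ordinal lt_im, j); rewrite def_j addnS eqxx /=.
by move=> /negbT; rewrite -leqNgt.
Qed.

Lemma inversions0 n (s : 'S_n) : inversions s = set0 -> s = 1%g.
Proof.
move=> inv0; have le_s (i j : 'I_n) : (i < j)%N -> (s i < s j)%N.
  move=> ij; have /setP/(_ (i, j)) := inv0.
  rewrite !inE /= ij /= => /negbT; rewrite -leqNgt leq_eqVlt => /orP[|//].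
  by move/eqP/val_inj/perm_inj => eij; rewrite eij ltnn in ij.
have ge_s m (i : 'I_n) : (i = m :> nat) -> (m <= s i)%N.
  elim: m i => // m IH i im.
  have lt_m : (m < n)%N by have := ltn_ord i; lia.
  apply: leq_ltn_trans (IH (Ordinal lt_m) erefl) _.
  by apply: le_s; rewrite /= im.
have le_si m (i : 'I_n) : (n = i + m.+1)%N -> (s i <= i)%N.
  elim: m i => [|m IH] i im; first by have := ltn_ord (s i); lia.
  have lt_i : (i.+1 < n)%N by lia.
  have := IH (Ordinal lt_i); have := le_s i (Ordinal lt_i) (leqnn _).
  by rewrite /= => h1 h2; have := h2 ltac:(lia); lia.
apply/permP => i; rewrite perm1; apply: val_inj; apply/eqP.
rewrite eqn_leq (ge_s i i erefl) // andbT (le_si (n - i).-1) //.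
by have := ltn_ord i; lia.
Qed.

Lemma reduced_wordP n (s : 'S_n) :
  size (reduced_word s) = #|inversions s| /\
  (\prod_(a <- reduced_word s) adj_perm n a)%g = s.
Proof.
rewrite /reduced_word.
have [m inv_s] : exists m, #|inversions s| = m by eexists.
rewrite inv_s.
elim: m s inv_s => [|m IH] s /= inv_s.
  by rewrite big_nil (inversions0 (cards0_eq inv_s)).
case: pickP => [[a b] /= /andP[/eqP ab sba] | nd]; last first.
  by rewrite (no_descent_inversions nd) cards0 in inv_s.
have [|sz pr] := IH (tperm a b * s)%g.
  by move: inv_s; rewrite (inversions_tperm ab sba) => -[].
split; first by rewrite /= sz.
rewrite big_cons pr /adj_perm -ab !valK.
by rewrite mulgA tperm2 mul1g.
Qed.

(* A braided vector space with basis I is given by the matrix of its          *)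
(* braiding: c(e_a (x) e_b) = \sum_(p, q) c (a, b) (p, q) . e_p (x) e_q.      *)
(* Its tensor algebra is the free algebra on I: the word [:: i_1; ..; i_n]    *)
(* stands for e_(i_1) (x) .. (x) e_(i_n).                                     *)

Notation tensor_algebra k I := {malg k[{fmonom I}]}.

Section Nichols.

Variables (k : fieldType) (I : finType) (c : I * I -> {ffun I * I -> k}).

Local Notation T := (tensor_algebra k I).

Definition word (w : seq I) : T := << FMonom w >>.

Definition tensor1 (u : {ffun I -> k}) : T := \sum_a u a *: word [:: a].

(* id^i (x) c (x) id^(n - i - 2) on words of length n; only used for          *)
(* i.+1 < n, the other case being a default value                             *)
Definition braid_word (i : nat) (w : seq I) : T :=
  if drop i w is [:: a, b & v] then
    \sum_p c (a, b) p *: word (take i w ++ [:: p.1, p.2 & v])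
  else word w.

Definition braid (i : nat) (t : T) : T :=
  \sum_(w <- msupp t) t@_w *: braid_word i w.

(* the product c_(a_1) o .. o c_(a_l) for a reduced word a_1 .. a_l of s *)
Definition matsumoto n (s : 'S_n) (t : T) : T :=
  foldr braid t (reduced_word s).

Definition quantum_symmetrizer (n : nat) (t : T) : T :=
  \sum_(s : 'S_n) matsumoto s t.

Definition hcomp (n : nat) (t : T) : T :=
  \sum_(w <- msupp t | size w == n) t@_w *: << w >>.

Definition nichols_ideal (t : T) : Prop :=
  [/\ hcomp 0 t = 0, hcomp 1 t = 0 &
      forall n, (1 < n)%N -> quantum_symmetrizer n (hcomp n t) = 0].

(* The Nichols algebra is the quotient of T by nichols_ideal: it is finite    *)
(* dimensional when finitely many elements of T span T modulo this ideal.     *)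
Definition nichols_finite_dim : Prop :=
  exists s : seq T, forall t : T, exists a : nat -> k,
    nichols_ideal (t - \sum_(i < size s) a i *: s`_i).

Lemma braidEw (d : {fset {fmonom I}}) i (t : T) : (msupp t `<=` d)%fset ->
  braid i t = \sum_(w <- d) t@_w *: braid_word i w.
Proof.
move=> le; rewrite /braid; apply: big_fset_incl => // w _ /mcoeff_outdom ->.
by rewrite scale0r.
Qed.

Lemma braid_is_linear i : linear (braid i).
Proof.
move=> a t u; pose d := (msupp t `|` msupp u `|` msupp (a *: t + u))%fset.
have dt : (msupp t `<=` d)%fset by apply/fsubsetP=> w; rewrite !inE => ->.
have du : (msupp u `<=` d)%fset.
  by apply/fsubsetP=> w; rewrite !inE => ->; rewrite orbT.
have dtu : (msupp (a *: t + u) `<=` d)%fset.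
  by apply/fsubsetP=> w; rewrite !inE => ->; rewrite orbT.
rewrite (braidEw _ dt) (braidEw _ du) (braidEw _ dtu) scaler_sumr -big_split /=.
by apply: eq_bigr => w _; rewrite mcoeffD mcoeffZ scalerDl scalerA.
Qed.

HB.instance Definition _ i :=
  GRing.isLinear.Build k T T _ (braid i) (braid_is_linear i).

Lemma braidU i (w : seq I) : braid i (word w) = braid_word i w.
Proof. by rewrite /braid msuppU1 big_seq_fset1 mcoeffUU scale1r. Qed.

Lemma wordM (v w : seq I) : word v * word w = word (v ++ w).
Proof.
rewrite /word malgM_def fgmulUU mulr1; congr << _ >>.
by apply/val_inj; rewrite /= fmM.
Qed.

Lemma malg_scalerAr a (t u : T) : t * (a *: u) = a *: (t * u).
Proof.
rewrite (malgMEw (fsubset_refl _) (msuppZ_le a u)) malgME scaler_sumr.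
apply: eq_bigr => v _; rewrite scaler_sumr; apply: eq_bigr => w _.
rewrite (mcoeffZ a u w) mulrCA; apply/malgP=> z.
by rewrite [LHS]mcoeffU [RHS]mcoeffZ [X in _ = a * X]mcoeffU mulrnAr.
Qed.

Lemma tensor1_sum (J : finType) (a : J -> k) (u : J -> {ffun I -> k}) :
  tensor1 [ffun i => \sum_j a j * u j i] = \sum_j a j *: tensor1 (u j).
Proof.
under [RHS]eq_bigr do rewrite scaler_sumr.
rewrite exchange_big /=; apply: eq_bigr => i _.
by rewrite ffunE scaler_suml; apply: eq_bigr => j _; rewrite scalerA.
Qed.

Lemma tensor1_delta a : tensor1 [ffun b => (b == a)%:R] = word [:: a].
Proof.
rewrite /tensor1 (bigD1 a) //= ffunE eqxx scale1r big1 ?addr0 // => b /negPf ba.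
by rewrite ffunE ba scale0r.
Qed.

End Nichols.

(* M(C, rho) = kG (x)_(kH) V, where H = C_G(g) and V = k^n is the space of    *)
(* column vectors on which h \in H acts on the left by rho h.  It has basis   *)
(* repr X (x) e_j, for X a left coset of H in G and j : 'I_n.                 *)
Section YetterDrinfeld.

Variables (k : fieldType) (gT : finGroupType) (G : {group gT}) (g : gT).
Variables (n : nat) (rho : mx_representation k 'C_G[g] n).

Local Notation H := 'C_G[g]%g.

Definition yd_basis : finType :=
  ({X : {set gT} | X \in lcosets H G} * 'I_n)%type.

(* x (x) v for x \in G: if x = repr X * h with h \in H, then                  *)
(* x (x) v = repr X (x) h.v                                                   *)
Definition yd_tensor (x : gT) (v : 'cV[k]_n) : {ffun yd_basis -> k} :=
  [ffun p : yd_basis =>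
     if x \in val p.1 then (rho ((repr (val p.1))^-1 * x)%g *m v) p.2 0
     else 0].

Definition yd_braiding (ab : yd_basis * yd_basis) :
    {ffun yd_basis * yd_basis -> k} :=
  let x := repr (val ab.1.1) in let v := delta_mx ab.1.2 0 in
  let y := repr (val ab.2.1) in let w := delta_mx ab.2.2 0 in
  [ffun pq : yd_basis * yd_basis =>
     yd_tensor (x * g * x^-1 * y)%g w pq.1 * yd_tensor x v pq.2].

Lemma yd_tensor_linear x v :
  yd_tensor x v = [ffun p => \sum_j v j 0 * yd_tensor x (delta_mx j 0) p].
Proof.
apply/ffunP=> p; rewrite !ffunE; under eq_bigr do rewrite ffunE.
case: ifP => _; last by rewrite big1 // => j _; rewrite mulr0.
rewrite mxE; apply: eq_bigr => j _; rewrite mulrC; congr (_ * _).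
rewrite mxE (bigD1 j) //= big1 ?addr0 ?mxE ?eqxx ?mulr1 // => l /negPf lj.
by rewrite mxE lj mulr0.
Qed.

Lemma yd_tensor_balanced x h v : x \in G -> h \in H ->
  yd_tensor (x * h)%g v = yd_tensor x (rho h *m v).
Proof.
move=> Gx Hh; apply/ffunP=> -[[X HX] j]; rewrite !ffunE /=.
have [y Gy defX] := imsetP HX.
have Xy : y \in X by rewrite defX lcosetE lcoset_refl.
have /lcosetP[r Hr rX] : repr X \in (y *: H)%g.
  by rewrite -lcosetE -defX (mem_repr y).
have in_X z : (z \in X) = ((y^-1 * z)%g \in H).
  by rewrite defX lcosetE mem_lcoset.
rewrite !in_X mulgA groupMr //; case: ifP => // Hyx.
have HrX : ((repr X)^-1 * x)%g \in H by rewrite rX invMg -mulgA groupM ?groupV.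
by rewrite (mulgA _ x h) repr_mxM // mulmxA.
Qed.

Lemma yd_tensor_repr (p : yd_basis) :
  yd_tensor (repr (val p.1)) (delta_mx p.2 0) =
  [ffun q : yd_basis => (q == p)%:R].
Proof.
case: p => X i; apply/ffunP=> -[Y j]; rewrite !ffunE /= xpair_eqE.
have cosetP (Z : {X : {set gT} | X \in lcosets H G}) :
    (repr (val Z) *: H)%g = val Z.
  case: Z => _ /= /imsetP[y Gy ->]; rewrite lcosetE.
  by apply/lcoset_eqP/(mem_repr y)/lcoset_refl.
have -> : (repr (val X) \in val Y) = (Y == X).
  apply/idP/eqP => [|->]; last by rewrite -[in X in _ \in X]cosetP lcoset_refl.
  rewrite -{1}(cosetP Y) => /lcoset_eqP; rewrite !cosetP => e.
  exact/esym/val_inj.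
case: eqP => [->|//]; rewrite mulVg repr_mx1 mul1mx mxE eqxx andbT.
by rewrite eq_sym.
Qed.

Lemma yd_braidingE x y v w : g \in G -> x \in G -> y \in G ->
  braid yd_braiding 0 (tensor1 (yd_tensor x v) * tensor1 (yd_tensor y w)) =
  tensor1 (yd_tensor (x * g * x^-1 * y)%g w) * tensor1 (yd_tensor x v).
Proof.
have tE z u : tensor1 (yd_tensor z u) =
    \sum_j u j 0 *: tensor1 (yd_tensor z (delta_mx j 0)).
  by rewrite -tensor1_sum [in LHS]yd_tensor_linear.
have decomp z : z \in G -> exists (X : {X : {set gT} | X \in lcosets H G}) h,
    [/\ repr (val X) \in G, h \in H & z = (repr (val X) * h)%g].
  move=> Gz; have HX : (z *: H)%g \in lcosets H G.
    by apply/imsetP; exists z; rewrite ?lcosetE.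
  have /lcosetP[h Hh rz] := mem_repr z (lcoset_refl 'C_G[g]%G z).
  exists (exist (fun X : {set gT} => X \in lcosets H G) _ HX), h^-1%g.
  rewrite groupV Hh /= rz mulgK; split=> //.
  by rewrite groupM //; case/setIP: Hh.
move=> Gg /decomp[X [h [GX Hh ->]]] /decomp[Y [h' [GY Hh' ->]]].
have Gg' (z : gT) : z \in G -> (repr (val X) * g * (repr (val X))^-1 * z)%g \in G.
  by move=> Gz; rewrite !groupM ?groupV.
have -> : (repr (val X) * h * g * (repr (val X) * h)^-1 * (repr (val Y) * h') =
    repr (val X) * g * (repr (val X))^-1 * repr (val Y) * h')%g.
  have /cent1P hg : h \in 'C[g]%g by case/setIP: Hh.
  by rewrite invMg !mulgA -(mulgA _ h g) hg !mulgA mulgK.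
rewrite !(yd_tensor_balanced _ _ Hh) ?(yd_tensor_balanced _ _ Hh') ?Gg' //.
move: (rho h *m v) (rho h' *m w) => {}v {}w.
have rE (Z : {X : {set gT} | X \in lcosets H G}) j :
    tensor1 (yd_tensor (repr (val Z)) (delta_mx j 0)) = word k [:: (Z, j)].
  by rewrite -tensor1_delta -yd_tensor_repr.
rewrite !(tE _ v) !(tE _ w).
rewrite [X in braid _ _ X]mulr_suml [RHS]mulr_suml raddf_sum /=.
under eq_bigr do rewrite mulr_sumr raddf_sum.
rewrite exchange_big /=; apply: eq_bigr => j _.
rewrite [RHS]mulr_sumr; apply: eq_bigr => i _.
rewrite !rE -!scalerAl !malg_scalerAr wordM !linearZ /= braidU !scalerA mulrC.
congr (_ *: _); rewrite /braid_word /= -[in RHS]rE /tensor1 big_distrlr /=.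
rewrite pair_big /=; apply: eq_bigr => -[p q] _; rewrite ffunE /=.
by rewrite -scalerAl malg_scalerAr wordM scalerA.
Qed.

End YetterDrinfeld.

(* MathComp representations act on row vectors from the right; irreducibility *)
(* of that action is the same as irreducibility of the left action on column  *)
(* vectors, whose invariant subspaces are the column spaces stable under rho. *)
Lemma mx_irreducible_col (k : fieldType) (gT : finGroupType) (G : {group gT})
    (n : nat) (rho : mx_representation k G n) :
  mx_irreducible rho <->
  (0 < n)%N /\
  forall U : 'M[k]_n,
    (forall x, x \in G -> ((rho x *m U)^T <= U^T)%MS) ->
    \rank U = 0%N \/ \rank U = n.
Proof.
split=> [/mx_irrP[n_gt0 irr] | [n_gt0 irr]]; first split=> // U stU.
  have kerU : mxmodule rho (kermx U).
    apply/mxmoduleP=> x Gx; apply/sub_kermxP.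
    have /submxP[D /(congr1 trmx)] := stU x Gx.
    by rewrite !trmx_mul !trmxK -mulmxA => ->; rewrite mulmxA mulmx_ker mul0mx.
  have [->|] := eqVneq (\rank U) n; [by right | move=> rU; left].
  have := irr _ kerU; rewrite -mxrank_eq0 mxrank_ker subn_eq0 -ltnNge.
  rewrite ltn_neqAle rU rank_leq_row => /(_ isT).
  rewrite /row_full mxrank_ker => /eqP; have := rank_leq_row U; lia.
apply/mx_irrP; split=> // U modU nzU.
have stV x : x \in G -> ((rho x *m cokermx U)^T <= (cokermx U)^T)%MS.
  move=> Gx; have /submxP[D defU] := mxmoduleP modU x Gx.
  have : U *m (rho x *m cokermx U) = 0.
    by rewrite mulmxA defU -mulmxA mulmx_coker mulmx0.
  move/(congr1 trmx); rewrite trmx_mul trmx0 => /sub_kermxP/submx_trans; apply.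
  rewrite -(mxrank_leqif_sup _) ?mxrank_ker ?mxrank_tr ?mxrank_coker //.
  by apply/sub_kermxP; rewrite -trmx_mul mulmx_coker trmx0.
have := irr _ stV; rewrite mxrank_coker /row_full.
have := rank_leq_row U; move: nzU; rewrite -mxrank_eq0; lia.
Qed.

Definition class_typeB (k : fieldType) (gT : finGroupType) (G : {group gT})
    (g : gT) : Prop :=
  forall (n : nat) (rho : mx_representation k 'C_G[g] n),
    mx_irreducible rho -> ~ nichols_finite_dim (yd_braiding rho).

Definition group_typeB (k : fieldType) (gT : finGroupType) (G : {group gT}) :
    Prop :=
  forall g, g \in G -> class_typeB k G g.

Section MathieuGroups.

Variable F : finFieldType.

Definition SL3 : {set {'GL_3[F]}} := [set A | \det (GLval A) == 1].

Fact SL3_group_set : group_set SL3.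
Proof.
apply/group_setP; split=> [|A B]; first by rewrite inE det1.
by rewrite !inE => /eqP dA /eqP dB; rewrite det_mulmx dA dB mulr1.
Qed.
Canonical SL3_group := Group SL3_group_set.

Definition PSL3 : {group coset_of 'Z(SL3)} := (SL3 / 'Z(SL3))%G.

(* the points of the projective plane, as lines of F^3 (0 included) *)
Definition points : {set {set 'rV[F]_3}} :=
  [set [set a *: v | a : F] | v : 'rV[F]_3 & v != 0].

(* A \in SL3 sends P to P A; Z(SL3) consists of scalar matrices, so this      *)
(* factors through PSL3 on points (see point_actionE below).                  *)
Definition point_action := (('MR (GLrepr F 2))^* %% 'Z(SL3))%act.

Lemma det_transvection (i j : 'I_3) : i != j ->
  \det (1%:M + delta_mx i j : 'M[F]_3) = 1.
Proof.
have trig (a b : 'I_3) : (b < a)%N -> \det (1%:M + delta_mx a b : 'M[F]_3) = 1.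
  move=> ba; rewrite det_trig.
    rewrite big1 // => l _; rewrite !mxE eqxx.
    by case: eqP => [->|_]; rewrite /= ?addr0 // -val_eqE gtn_eqF ?addr0.
  apply/is_trig_mxP => l m lm; rewrite !mxE -val_eqE ltn_eqF //= add0r.
  case: eqP => //= la; case: eqP => //= mb; move: lm ba; rewrite la mb.
  by case: ltngtP.
rewrite neq_ltn => /orP[ij | ji]; last exact: trig.
by rewrite -det_tr linearD /= tr_scalar_mx trmx_delta trig.
Qed.

Lemma center_SL3_scalar (A : {'GL_3[F]}) :
  A \in 'Z(SL3)%g -> exists a, GLval A = a%:M.
Proof.
case/centerP=> _ cA; have cE (i j : 'I_3) : i != j ->
    GLval A *m delta_mx i j = delta_mx i j *m GLval A.
  move=> /det_transvection; set E := 1%:M + _ => dE.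
  have uE : E \in unitmx by rewrite unitmxE dE unitr1.
  have /(congr1 GLval) : (A * FinRing.unit _ uE = FinRing.unit _ uE * A)%g.
    by apply: cA; rewrite inE /= dE.
  rewrite /= [LHS]mulrDr [RHS]mulrDl mulr1 mul1r; exact: addrI.
exists (GLval A 0 0); apply/matrixP=> i j; rewrite mxE.
have mE (B : 'M[F]_3) a b l m : (B *m delta_mx a b) l m = B l a *+ (m == b).
  rewrite mxE (bigD1 a) //= big1 ?addr0; last first.
    by move=> h /negPf ha; rewrite !mxE ha /= mulr0.
  by rewrite mxE eqxx /=; case: (m == b); rewrite ?mulr1 ?mulr0.
have mE' (B : 'M[F]_3) a b l m : (delta_mx a b *m B) l m = B b m *+ (l == a).
  rewrite mxE (bigD1 b) //= big1 ?addr0; last first.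
    by move=> h /negPf ha; rewrite !mxE ha andbF mul0r.
  by rewrite mxE eqxx andbT; case: (l == a); rewrite ?mul1r ?mul0r.
case: eqP => [<- | /eqP ij].
  have [-> // | i0] := eqVneq i 0.
  by have /matrixP/(_ i 0) := cE _ _ i0; rewrite mE mE' !eqxx.
have /matrixP/(_ i i) := cE _ _ ij.
have /matrixP/(_ i i) := cE j i (introN eqP (fun e => negP ij (introT eqP (esym e)))).
by rewrite !mE !mE' eqxx (negPf ij).
Qed.

Lemma point_actionE (P : {set 'rV[F]_3}) (A : {'GL_3[F]}) :
  P \in points -> A \in SL3 ->
  point_action P (coset 'Z(SL3)%g A) = [set v *m GLval A | v in P].
Proof.
case/imsetP=> v _ -> SA; rewrite /= modactE.
- by rewrite /setact; apply: eq_imset => u; rewrite /= mx_repr_actE ?inE.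
- by rewrite inE.
- exact: (subsetP (normal_norm (center_normal SL3_group))).
apply/afixP => Z /setIP[_ /center_SL3_scalar[a ZE]].
apply/eqP; rewrite eqEcard card_setact leqnn andbT /= /setact.
apply/subsetP=> _ /imsetP[_ /imsetP[b _ ->] ->]; apply/imsetP.
by exists (a * b); rewrite //= mx_repr_actE ?inE //= ZE mul_mx_scalar scalerA.
Qed.

End MathieuGroups.

Definition M21 (F : finFieldType) : {group coset_of 'Z(SL3 F)} := PSL3 F.

Definition M20 (F : finFieldType) (P : {set 'rV[F]_3}) :
    {group coset_of 'Z(SL3 F)} := 'C_(PSL3 F)[P | point_action F]%G.

(* Main.v *)
Require Import Defs.
From HB Require Import structures.
From mathcomp Require Import all_boot all_order all_fingroup all_algebra.
From mathcomp Require Import all_solvable all_field all_character.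
From mathcomp Require Import finmap zify ring.
From mathcomp Require Import monalg.
From Stdlib Require Import FunctionalExtensionality.

(** Let v be a common eigenvector in V of the conjugates of g at hand that lie
    in the centralizer of g.  The vectors e_a = x_a (x) v, for finitely many
    x_a in G lying in distinct cosets, span a braided subspace of diagonal
    type: c(e_a (x) e_b) = q_ab e_b (x) e_a with q_ab in k
    ([yd_diagonal_infinite]).  On words in the e_a the quantum symmetrizers
    compute products of letters in the quantum shuffle algebra of q
    ([quantum_symmetrizer_shuffle]), so it is enough to find nonzero products
    of arbitrarily large degree ([nichols_infinite]).

    In the shuffle algebra, left multiplication L_j by the letter j and the
    skew derivation d_i that removes a first letter i satisfy
    d_i L_j = delta_ij + q_ji L_j d_i.  Let z be an iterated braided commutator
    of distinct letters, such that the product of all q_ij over these letters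
    is 1.  All but one of the d_i kill z, and therefore the composite D of the
    d_i over the letters of z acts on the powers of z as a derivation:
    D(z^n) = n C z^(n-1) with a constant C.  In characteristic zero and for
    C != 0 no power of z vanishes ([shuffle_unbounded_of_derivation]).
    Let x be the eigenvalue of g on v.  The argument is applied
    - to one letter, when x = 1;
    - to two letters with q_11 = q_22 = x and q_12 q_21 = x^-2, when t in G
      inverts g and g has odd order ([class_typeB_real]);
    - to three letters with q_ii = x and q_ij q_ji = x^-1, when g commutes with
      its conjugate by t in G, the product of the conjugates of g by 1, t, t^2
      is 1, and the order of g is prime to 3 ([class_typeB_triple]).

    Each element of the two groups satisfies one of these criteria.  Lift it to
    a matrix A in SL(3, 4), which may be multiplied by any nonzero scalar.  If A
    has an eigenvector p, scale A so that p A = p; on the quotient by p it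
    induces B with det B = 1.  When tr B != 0, A^15 = 1 and A is conjugate to
    its inverse; when tr B = 0, A is unitriangular in a suitable basis and t is
    a diagonal matrix with entries 1, w, w^2, where w is a primitive cube root
    of unity.  In both cases t can be chosen in the stabilizer of the line
    of p ([tamed_of_fixed]).  If A has no eigenvector,
    which only occurs in M21, some multiple of A is a root of a cubic polynomial
    over the field with two elements; then A^7 = 1, A is conjugate to A^2 and
    A A^2 A^4 = 1 ([tamed_of_irreducible]). *)

Set Implicit Arguments.
Unset Strict Implicit.
Unset Printing Implicit Defensive.

Import GRing.Theory.

(** * Braidings of words in the tensor algebra *)

Section BilinearSums.

Local Open Scope ring_scope.

Lemma linear_sum2 (k : fieldType) (J : finType) (U V : lmodType k)
    (f : {linear U -> V}) (s : J -> J -> k) (w : J -> J -> U) :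
  f (\sum_b \sum_a s a b *: w a b) = \sum_b \sum_a s a b *: f (w a b).
Proof.
rewrite linear_sum; apply: eq_bigr => b _.
by rewrite linear_sum; apply: eq_bigr => a _; rewrite linearZ.
Qed.

Lemma mulr_sum2l (k : fieldType) (J : finType) (A : lalgType k)
    (s : J -> J -> k) (w : J -> J -> A) (x : A) :
  (\sum_b \sum_a s a b *: w a b) * x = \sum_b \sum_a s a b *: (w a b * x).
Proof.
rewrite mulr_suml; apply: eq_bigr => b _.
by rewrite mulr_suml; apply: eq_bigr => a _; rewrite scalerAl.
Qed.

End BilinearSums.

Section TensorAlgebra.

Local Open Scope ring_scope.

Variables (k : fieldType) (I : finType) (c : I * I -> {ffun I * I -> k}).

Local Notation T := (tensor_algebra k I).
Local Notation word := (@word k I).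

Lemma tensor_ind (P : T -> Prop) :
  (forall w, P (word w)) ->
  (forall a t u, P t -> P u -> P (a *: t + u)) -> forall t, P t.
Proof.
move=> Pw PD t; have P0 : P 0.
  by rewrite -(addNr (word [::])) -scaleN1r; apply: PD; apply: Pw.
rewrite (monalgE t); elim: (enum_fset _) => [|w s IH]; first by rewrite big_nil.
rewrite big_cons; have -> : << t@_w *g w >> = t@_w *: word w.
  apply/malgP=> v; rewrite [LHS]mcoeffU [RHS]mcoeffZ [X in _ = _ * X]mcoeffU.
  by case: w => w; rewrite mulrnAr mulr1.
exact: PD.
Qed.

Lemma malg_linear (x : T) a t u : x * (a *: t + u) = a *: (x * t) + x * u.
Proof. by rewrite mulrDr malg_scalerAr. Qed.

Lemma braid_tensor1 i (e : {ffun I -> k}) (t : T) :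
  braid c i.+1 (tensor1 e * t) = tensor1 e * braid c i t.
Proof.
elim/tensor_ind: t => [w | a t u IHt IHu]; last first.
  apply: etrans (congr1 (braid c i.+1) (malg_linear _ _ _ _)) _.
  apply: etrans (braid_is_linear _ _ _ _ _) _.
  apply: etrans (congr2 (fun x y => a *: x + y) IHt IHu) _; apply/esym.
  exact: etrans (congr1 _ (braid_is_linear c i _ _ _)) (malg_linear _ _ _ _).
rewrite /tensor1 !mulr_suml linear_sum; apply: eq_bigr => a _.
rewrite -!scalerAl linearZ_LR /= wordM !braidU; congr (_ *: _).
rewrite /braid_word /=; case: (drop i w) => [|x [|y v]]; rewrite ?wordM //.
rewrite mulr_sumr; apply: eq_bigr => p _.
by rewrite malg_scalerAr wordM.
Qed.

Lemma word0 : word [::] = 1.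
Proof.
by apply/malgP=> w; rewrite mcoeff1 [LHS]mcoeffU -!val_eqE /= fm1 eq_sym.
Qed.

Lemma tensor2_word (e e' : {ffun I -> k}) w :
  tensor1 e * (tensor1 e' * word w) =
  \sum_b \sum_a (e a * e' b) *: word [:: a, b & w].
Proof.
rewrite /tensor1 mulr_suml exchange_big; apply: eq_bigr => a _ /=.
rewrite -scalerAl mulr_suml mulr_sumr scaler_sumr; apply: eq_bigr => b _.
by rewrite -scalerAl malg_scalerAr scalerA !wordM.
Qed.

Lemma braid_head (e e' : {ffun I -> k}) (t : T) :
  braid c 0 (tensor1 e * (tensor1 e' * t)) =
  braid c 0 (tensor1 e * tensor1 e') * t.
Proof.
elim/tensor_ind: t => [w | a t u IHt IHu]; last first.
  apply: etrans (congr1 (fun x => braid c 0 (tensor1 e * x)) _) _.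
    exact: malg_linear.
  apply: etrans (congr1 (braid c 0) (malg_linear _ _ _ _)) _.
  apply: etrans (braid_is_linear _ _ _ _ _) _.
  apply: etrans (congr2 (fun x y => a *: x + y) IHt IHu) _.
  exact/esym/malg_linear.
have E2 : tensor1 e * tensor1 e' =
    \sum_b \sum_a (e a * e' b) *: word [:: a; b].
  apply: etrans (tensor2_word e e' [::]); congr (_ * _).
  by apply/esym/(etrans (congr1 _ word0))/mulr1.
apply: etrans (congr1 _ (tensor2_word e e' w)) _.
apply: etrans (linear_sum2 (braid c 0) _ _) _; apply/esym.
apply: etrans (congr1 (fun x => braid c 0 x * word w) E2) _.
apply: etrans (congr1 (fun x => x * word w) (linear_sum2 (braid c 0) _ _)) _.
apply: etrans (mulr_sum2l _ _ _) _.
apply: eq_bigr => b _; apply: eq_bigr => a _; congr (_ *: _).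
rewrite /= !braidU /braid_word /= mulr_suml; apply: eq_bigr => p _.
by rewrite -scalerAl wordM.
Qed.

Lemma mcoeff_tensor1 (e : {ffun I -> k}) (t : T) a v :
  (tensor1 e * t)@_(FMonom (a :: v)) = e a * t@_(FMonom v).
Proof.
elim/tensor_ind: t => [w | b t u IHt IHu]; last first.
  apply: etrans (congr1 _ (malg_linear _ _ _ _)) _; rewrite !mcoeffD.
  rewrite [X in X + _ = _]mcoeffZ [X in _ = _ * (X + _)]mcoeffZ.
  apply: etrans (congr2 (fun x y => b * x + y) IHt IHu) _.
  by move: (t@_ _) (u@_ _) => x y; rewrite mulrDr mulrCA.
rewrite /tensor1 mulr_suml raddf_sum (bigD1 a) //= big1 ?addr0 => [|b ba].
  rewrite -scalerAl wordM [LHS]mcoeffZ; congr (_ * _).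
  by rewrite [LHS]mcoeffU [RHS]mcoeffU -!val_eqE /= eqseq_cons eqxx.
rewrite -scalerAl wordM [LHS]mcoeffZ [X in _ * X]mcoeffU -val_eqE /=.
by rewrite eqseq_cons (negPf ba) mulr0.
Qed.

Lemma hcompE n (t : T) (w : {fmonom I}) :
  (hcomp n t)@_w = if size w == n then t@_w else 0.
Proof.
rewrite /hcomp raddf_sum /=.
have E v : (t@_v *: << v >>)@_w = t@_v *+ (v == w).
  by rewrite [LHS]mcoeffZ [X in _ * X]mcoeffU mulrnAr mulr1.
under eq_bigr do rewrite E.
case: (boolP (w \in msupp t)) => [tw|tw].
  case: ifP => sw.
    rewrite (big_rem w) //= sw eqxx mulr1n big_seq_cond big1 ?addr0 // => v.
    rewrite (mem_rem_uniq _ (fset_uniq _)) inE => /andP[/andP[vw _] _].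
    by rewrite (negPf vw).
  by rewrite big1 // => v /eqP sv; case: eqP => // vw; rewrite -sv vw eqxx in sw.
rewrite (mcoeff_outdom tw) if_same big_seq_cond big1 // => v /andP[tv _].
by case: eqP => // vw; rewrite -vw tv in tw.
Qed.

End TensorAlgebra.

Section DiagonalBraiding.

Local Open Scope ring_scope.

Variables (k : fieldType) (I : finType) (c : I * I -> {ffun I * I -> k}).
Variables (A : eqType) (e : A -> {ffun I -> k}) (q : A -> A -> k).

Hypothesis braidE : forall a b,
  braid c 0 (tensor1 (e a) * tensor1 (e b)) =
  q a b *: (tensor1 (e b) * tensor1 (e a)).

Local Notation T := (tensor_algebra k I).

Definition tensor_word (w : seq A) : T :=
  foldr (fun a t => tensor1 (e a) * t) 1 w.

Lemma braid_tensor_word (u v : seq A) a b :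
  braid c (size u) (tensor_word (u ++ [:: a, b & v])) =
  q a b *: tensor_word (u ++ [:: b, a & v]).
Proof.
elim: u => [|x u IH] /=; last first.
  apply: etrans (braid_tensor1 _ _ _ _) _.
  by apply: etrans (congr1 _ IH) (malg_scalerAr _ _ _).
apply: etrans (braid_head _ _ _ _) _.
apply: etrans (congr1 (fun t => t * _) (braidE a b)) _.
by rewrite -scalerAl -mulrA.
Qed.

Section Words.

Variable N : nat.

Definition ord_word (w : 'I_N -> A) : seq A := [seq w i | i <- enum 'I_N].

Lemma ord_word_swap (w : 'I_N -> A) (i j : 'I_N) : j = i.+1 :> nat ->
  braid c i (tensor_word (ord_word w)) =
  q (w i) (w j) *: tensor_word (ord_word (w \o tperm i j)).
Proof.
move=> ij; set u := take i (enum 'I_N); set v := drop i.+2 (enum 'I_N).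
have defE : enum 'I_N = u ++ [:: i, j & v].
  rewrite /v -{1}(cat_take_drop i (enum 'I_N)) (drop_nth i) ?size_enum_ord //.
  rewrite (drop_nth i) ?size_enum_ord -?ij // nth_ord_enum; congr (_ ++ _ :: _ :: _).
  by rewrite nth_ord_enum.
have szu : size (map w u) = i.
  by rewrite size_map size_takel // size_enum_ord ltnW.
have := enum_uniq 'I_N; rewrite defE cat_uniq /= !inE !negb_or -!andbA.
case/and5P=> _ iu ju _ /and4P[_ iv jv _].
have fix_t s : i \notin s -> j \notin s -> map (w \o tperm i j) s = map w s.
  move=> si sj; apply/eq_in_map => x sx /=.
  by rewrite tpermD //; apply: contraTneq sx => <-.
rewrite /ord_word defE !map_cat /= !fix_t // tpermL tpermR -{1}szu.
exact: braid_tensor_word.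
Qed.

(** The inversions of s other than (a, b) are the images under the transposition
    of those of the shorter permutation, so that a product over inversions can
    be accumulated along a reduced word. *)
Lemma inversions_descent (s : 'S_N) (a b : 'I_N) :
  b = a.+1 :> nat -> (s b < s a)%N ->
  let f p := (tperm a b p.1, tperm a b p.2) in
  inversions s = (a, b) |: f @: inversions (tperm a b * s)%g /\
  (a, b) \notin f @: inversions (tperm a b * s)%g.
Proof.
move=> ab sba f; set t := tperm a b.
have f_inj : injective f by move=> [i j] [i' j'] [/perm_inj-> /perm_inj->].
have nf : (a, b) \notin f @: inversions (t * s)%g.
  apply/imsetP => -[[i j]]; rewrite inE => /andP[/= ij _] [ai bj].
  have ib : i = b by rewrite -(tpermK a b i) -ai tpermL.
  have ja : j = a by rewrite -(tpermK a b j) -bj tpermR.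
  by move: ij; rewrite ib ja ab; lia.
split=> //; have sub : (a, b) |: f @: inversions (t * s)%g \subset inversions s.
  apply/subsetP=> p; rewrite in_setU1 => /orP[/eqP-> | ].
    by rewrite inE /= ab leqnn sba.
  case/imsetP=> -[i j]; rewrite inE /= !permM => /andP[ij inv] ->.
  rewrite inE /= inv andbT -/t.
  have ne : (i, j) != (a, b).
    by apply: contraL inv => /eqP[-> ->]; rewrite -/t tpermL tpermR; lia.
  move: ne ij; rewrite /t xpair_eqE.
  case: tpermP => [->|->|/eqP ia /eqP ib];
    case: tpermP => [->|->|/eqP ja /eqP jb];
    rewrite ?eqxx ?ltnn //= -?val_eqE /= -?val_eqE /=; lia.
apply/esym/eqP; rewrite eqEcard sub (inversions_tperm ab sba) cardsU1 nf.
by rewrite (card_imset _ f_inj) leqnn.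
Qed.

(** Along a reduced word each simple braiding exchanges two adjacent letters,
    and every inversion is created exactly once. *)
Lemma matsumoto_tensor_word (s : 'S_N) (w : 'I_N -> A) :
  matsumoto c s (tensor_word (ord_word w)) =
  (\prod_(p in inversions s) q (w (s p.2)) (w (s p.1)))
    *: tensor_word (ord_word (w \o s)).
Proof.
rewrite /matsumoto /reduced_word.
have [m inv_s] : exists m, #|inversions s| = m by eexists.
rewrite inv_s; elim: m s inv_s => [|m IH] s inv_s.
  have inv0 := cards0_eq inv_s; rewrite inv0 big_set0 scale1r /=.
  congr (tensor_word _); apply: eq_map => i /=.
  by rewrite (inversions0 inv0) perm1.
rewrite /=; case: pickP => [[a b] /= /andP[/eqP ab sba] | nd]; last first.
  by rewrite (no_descent_inversions nd) cards0 in inv_s.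
have cts : #|inversions (tperm a b * s)%g| = m.
  by move: inv_s; rewrite (inversions_tperm ab sba) => -[].
rewrite /=; apply: etrans (congr1 _ (IH _ cts)) _.
apply: etrans (linearZ_LR _ _ _) _ => /=.
apply: etrans (congr1 _ (ord_word_swap _ ab)) _; rewrite scalerA.
have [-> nf] := inversions_descent ab sba.
rewrite (big_setU1 _ nf) [X in X *: _]mulrC; congr (_ * _ *: tensor_word _).
- by rewrite /= !permM tpermL tpermR.
- rewrite big_imset /=; last first.
    by move=> [i j] [i' j'] _ _ [/perm_inj-> /perm_inj->].
  by apply: eq_bigr => -[i j] _; rewrite /= !permM.
by apply: eq_map => i; rewrite /= permM tpermK.
Qed.

End Words.
End DiagonalBraiding.

(** * Quantum symmetrizers as quantum shuffles *)

Section Shuffle.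

Local Open Scope ring_scope.

Variables (k : fieldType) (A : eqType) (q : A -> A -> k).

(** Left multiplication by the letter j in the quantum shuffle algebra, whose
    elements are represented by their coefficients on words: j is inserted at
    every place and contributes q j i for each letter i that it crosses. *)
Fixpoint shuffle1 (j : A) (f : seq A -> k) (u : seq A) : k :=
  if u is i :: v then
    (i == j)%:R * f v + q j i * shuffle1 j (fun v => f (i :: v)) v
  else 0.

Definition shuffle (w : seq A) : seq A -> k :=
  foldr shuffle1 (fun u => (u == [::])%:R) w.

Lemma shuffle1E j f u x0 : shuffle1 j f u =
  \sum_(p < size u) (nth x0 u p == j)%:R *
    (\prod_(a < size u | (a < p)%N) q j (nth x0 u a)) *
    f (take p u ++ drop p.+1 u).
Proof.
elim: u f => [|i u IH] f /=; first by rewrite big_ord0.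
rewrite big_ord_recl /= big_pred0 // mulr1 drop0 /=; congr (_ + _).
rewrite IH mulr_sumr; apply: eq_bigr => p _.
rewrite [X in _ = _ * X * _]big_mkcond big_ord_recl /= [in LHS]big_mkcond.
rewrite !mulrA [q j i * _]mulrC; congr (_ * _ * _).
Qed.

(** Coefficient at u of the quantum symmetrizer applied to w, for a diagonal
    braiding. *)
Definition perm_sum N (w u : 'I_N -> A) : k :=
  \sum_(s : 'S_N | [forall i, w (s i) == u i])
    \prod_(a < N) \prod_(b < N | (a < b)%N && (s b < s a)%N) q (u b) (u a).

(** A permutation amounts to the place p that it sends to 0 and a permutation
    of the remaining places. *)
Lemma sum_perm_lift N (F : 'S_N.+1 -> k) :
  \sum_s F s = \sum_(p < N.+1) \sum_(s : 'S_N) F (lift_perm p ord0 s).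
Proof.
rewrite (partition_big (fun s : 'S_N.+1 => (s^-1)%g ord0) predT) //=.
apply: eq_bigr => p _; rewrite (reindex (lift_perm p ord0)) /=.
  apply: eq_bigl => s.
  by rewrite -[X in _ (_^-1)%g X](lift_perm_id p ord0 s) permK eqxx.
pose ulsf i (s : 'S_N.+1) k0 := odflt k0 (unlift (s i) (s (lift i k0))).
have ulsfK i (s : 'S_N.+1) k0 : lift (s i) (ulsf i s k0) = s (lift i k0).
  rewrite /ulsf; have:= neq_lift i k0.
  by rewrite -(can_eq (permK s)) => /unlift_some[] ? ? ->.
have inj_ulsf : injective (ulsf p _).
  move=> s; apply: can_inj (ulsf (s p) s^-1%g) _ => k'.
  by rewrite {1}/ulsf ulsfK !permK liftK.
exists (fun s => perm (inj_ulsf s)) => [s _ | s].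
  by apply/permP=> k'; rewrite permE /ulsf lift_perm_lift lift_perm_id liftK.
rewrite unfold_in => /eqP/(canRL (permKV s)) sp.
apply/permP=> k0; case: (unliftP p k0) => [k'|] ->; rewrite ?lift_perm_id //.
by rewrite lift_perm_lift permE [in LHS]sp ulsfK.
Qed.

(** If the first letter of w lands at the place p, the inversions that involve p
    are the pairs (a, p) with a < p: this is the rule for inserting a letter in
    the quantum shuffle algebra. *)
Lemma perm_sum_recl N (w u : 'I_N.+1 -> A) : perm_sum w u =
  \sum_(p < N.+1) (u p == w ord0)%:R *
    (\prod_(a < N.+1 | (a < p)%N) q (w ord0) (u a)) *
    perm_sum (w \o lift ord0) (u \o lift p).
Proof.
rewrite /perm_sum big_mkcond sum_perm_lift; apply: eq_bigr => p _.
rewrite -big_mkcond mulr_sumr /=.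
have -> : \sum_(s : 'S_N |
      [forall i, (w \o lift ord0) (s i) == (u \o lift p) i])
    (u p == w ord0)%:R * (\prod_(a < N.+1 | (a < p)%N) q (w ord0) (u a)) *
    (\prod_(a < N) \prod_(b < N | (a < b)%N && (s b < s a)%N)
       q ((u \o lift p) b) ((u \o lift p) a)) =
  \sum_(s : 'S_N | (u p == w ord0) &&
      [forall i, (w \o lift ord0) (s i) == (u \o lift p) i])
    (\prod_(a < N.+1 | (a < p)%N) q (w ord0) (u a)) *
    (\prod_(a < N) \prod_(b < N | (a < b)%N && (s b < s a)%N)
       q ((u \o lift p) b) ((u \o lift p) a)).
  case: eqP => _ /=; first by apply: eq_bigr => s _; rewrite mul1r.
  by rewrite big_pred0_eq big1 // => s _; rewrite !mul0r.
apply: eq_big => [s | s].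
  apply/forallP/andP => [h | [/eqP h0 /forallP h] i].
    have := h p; rewrite lift_perm_id eq_sym => h0; split=> //.
    by apply/forallP=> i; have := h (lift p i); rewrite lift_perm_lift.
  case: (unliftP p i) => [i'|] ->; last by rewrite lift_perm_id h0.
  by rewrite lift_perm_lift; apply: h.
move/forallP=> h; have h0 : w ord0 = u p.
  by apply/eqP; have := h p; rewrite lift_perm_id.
rewrite (bigD1_ord p) //= [X in X * _]big_pred0 ?mul1r; last first.
  by move=> b; rewrite lift_perm_id ltn0 andbF.
rewrite (big_mkcond (fun a : 'I_N.+1 => _)) (bigD1_ord p) //= ltnn mul1r.
rewrite -big_split /=; apply: eq_bigr => a _.
rewrite big_mkcond (bigD1_ord p) //=; congr (_ * _).
  by rewrite lift_perm_id lift_perm_lift h0 /= /bump add1n ltn0Sn andbT.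
rewrite [RHS]big_mkcond; apply: eq_bigr => b _.
rewrite !lift_perm_lift /=; congr (if _ then _ else _).
rewrite /bump; lia.
Qed.

Lemma perm_sum_shuffle (w u : seq A) x0 : size w = size u ->
  perm_sum (fun i : 'I_(size u) => nth x0 w i) (fun i => nth x0 u i) =
  shuffle w u.
Proof.
elim: w u => [|j w IH] [|i0 u] //= => [_|[sz]].
  rewrite /perm_sum (big_pred1 1%g) => [|s]; first by rewrite big_ord0.
  have -> : s = 1%g by apply/permP=> -[].
  by rewrite [pred1 _ _]eqxx; apply/forallP=> -[].
rewrite perm_sum_recl; apply: etrans (esym (shuffle1E _ _ (i0 :: u) x0)).
apply: eq_bigr => p _; congr (_ * _ * _).
set v := take p (i0 :: u) ++ drop p.+1 (i0 :: u).
have szv : size v = size u.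
  have := ltn_ord p; rewrite size_cat size_take size_drop /= => pl.
  by rewrite pl; lia.
rewrite -IH ?szv // /perm_sum.
have nthv (i : 'I_(size u)) : nth x0 (i0 :: u) (lift p i) = nth x0 v i.
  rewrite /v nth_cat size_take (ltn_ord p : (p < size (i0 :: u))%N) /= /bump.
  case: ltnP => ip; first by rewrite nth_take.
  by rewrite /= nth_drop subnKC.
apply: eq_big => [s | s _].
  by apply: eq_forallb => i /=; rewrite -nthv /bump.
by apply: eq_bigr => a _; apply: eq_bigr => b _ /=; rewrite -!nthv.
Qed.

End Shuffle.

(** * Infinite Nichols algebras of diagonal type *)

Section DiagonalNichols.

Local Open Scope ring_scope.

Variables (k : fieldType) (I : finType) (c : I * I -> {ffun I * I -> k}).
Variables (A : eqType) (e : A -> {ffun I -> k}) (q : A -> A -> k).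
Variables (x0 : A) (pivot : A -> I).

Hypothesis braidE : forall a b,
  braid c 0 (tensor1 (e a) * tensor1 (e b)) =
  q a b *: (tensor1 (e b) * tensor1 (e a)).
Hypothesis pivotE : forall a b, (e a (pivot b) != 0) = (a == b).

Local Notation T := (tensor_algebra k I).

(** The coordinate at [pivot b] is nonzero on [e b] only, so the coefficients at
    words of pivots separate the words in the vectors [e a]. *)
Lemma mcoeff_tensor_word (w u : seq A) : size w = size u ->
  (tensor_word e w)@_(FMonom (map pivot u)) =
  (w == u)%:R * \prod_(a <- u) e a (pivot a).
Proof.
elim: w u => [|a w IH] [|b u] //= => [_|[sz]].
  by rewrite big_nil mulr1 mcoeff1 -val_eqE /= fm1.
apply: etrans (mcoeff_tensor1 _ _ _ _) _.
rewrite (IH _ sz) big_cons eqseq_cons.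
have [<- | ab] := eqVneq a b; first by rewrite /= mulrCA.
by move: (pivotE a b); rewrite (negPf ab) => /negbFE/eqP->; rewrite !mul0r.
Qed.

Lemma tensor_word_homogeneous (w : seq A) (v : {fmonom I}) :
  size v != size w -> (tensor_word e w)@_v = 0.
Proof.
case: v => v /=; elim: w v => [|a w IH] [|b v] //= sz.
- by rewrite mcoeff1 -val_eqE /= fm1.
- rewrite /tensor1 mulr_suml raddf_sum big1 //= => i _.
  rewrite -scalerAl [LHS]mcoeffZ.
  have -> : (word k [:: i] * tensor_word e w)@_(FMonom [::]) = 0.
    move: (tensor_word e w) => t; elim/tensor_ind: t => [v | x t t' IHt IHt'].
      by rewrite wordM [LHS]mcoeffU -val_eqE.
    rewrite malg_linear mcoeffD IHt' addr0.
    by apply: etrans (mcoeffZ _ _ _) _; rewrite IHt mulr0.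
  by rewrite mulr0.
by apply: etrans (mcoeff_tensor1 _ _ _ _) _; rewrite IH ?mulr0.
Qed.

Lemma quantum_symmetrizer_shuffle (w u : seq A) : size w = size u ->
  (quantum_symmetrizer c (size u) (tensor_word e w))@_(FMonom (map pivot u)) =
  shuffle q w u * \prod_(a <- u) e a (pivot a).
Proof.
move=> sz; pose wf (i : 'I_(size u)) := nth x0 w i.
have wE : w = ord_word wf.
  apply: (@eq_from_nth _ x0) => [|i]; first by rewrite size_map size_enum_ord.
  rewrite sz => lt_i; rewrite (nth_map (Ordinal lt_i)) ?size_enum_ord // /wf.
  by rewrite nth_enum_ord.
rewrite -(perm_sum_shuffle q x0 sz) {1}wE /quantum_symmetrizer raddf_sum.
rewrite /perm_sum mulr_suml [RHS]big_mkcond; apply: eq_bigr => s _ /=.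
rewrite (matsumoto_tensor_word braidE s wf).
apply: etrans (mcoeffZ _ _ _) _.
rewrite mcoeff_tensor_word; last by rewrite size_map size_enum_ord.
have -> : (ord_word (wf \o s) == u) =
    [forall i : 'I_(size u), nth x0 w (s i) == nth x0 u i].
  apply/eqP/forallP => [def_u i | h].
    have := congr1 (fun v => nth x0 v i) def_u.
    by rewrite (nth_map i) ?size_enum_ord ?ltn_ord // nth_ord_enum => <-.
  apply: (@eq_from_nth _ x0) => [|i]; first by rewrite size_map size_enum_ord.
  rewrite size_map size_enum_ord => lt_i.
  rewrite (nth_map (Ordinal lt_i)) ?size_enum_ord //.
  have -> : nth (Ordinal lt_i) (enum 'I_(size u)) i = Ordinal lt_i.
    exact: (nth_ord_enum _ (Ordinal lt_i)).
  exact/eqP/(h (Ordinal lt_i)).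
case: forallP => [h | _]; last by rewrite mul0r mulr0.
rewrite mul1r; congr (_ * _); rewrite pair_big_dep /=.
apply: eq_big => [[a b] | [a b] _] /=; first by rewrite inE.
by rewrite /wf (eqP (h a)) (eqP (h b)).
Qed.

(** If finitely many elements spanned the Nichols algebra, its homogeneous
    components would vanish in all degrees beyond theirs, and so would the
    corresponding quantum symmetrizers. *)
Theorem nichols_infinite :
  (forall m, exists w u, [/\ size w = size u, (m < size u)%N &
                             shuffle q w u != 0]) ->
  ~ nichols_finite_dim c.
Proof.
move=> large [s s_span].
pose D := (\max_(t <- s) \max_(x <- msupp t) size x)%N.
(* the ideal only involves the quantum symmetrizers of degree at least 2 *)
have [w [u [sz lt_m nz]]] := large (maxn 1 D).
have [a] := s_span (tensor_word e w).
case=> _ _ /(_ (size u)); case: (leqP _ 1%N) => [|_ /(_ isT)]; first by lia.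
have -> : hcomp (size u) (tensor_word e w - \sum_(i < size s) a i *: s`_i) =
          tensor_word e w.
  apply/malgP=> v; apply: etrans (hcompE _ _ _) _.
  case: eqP => [sv | /eqP]; last first.
    by rewrite -sz => sv; apply/esym/tensor_word_homogeneous.
  rewrite mcoeffB raddf_sum big1 ?subr0 //= => i _.
  apply: etrans (mcoeffZ _ _ _) _; rewrite mcoeff_outdom ?mulr0 //.
  apply/negP=> vs; suff : (size v <= D)%N by lia.
  rewrite /D (big_rem s`_i) ?mem_nth //= (big_rem v) //=; lia.
move/(congr1 (mcoeff (FMonom (map pivot u)))).
rewrite (quantum_symmetrizer_shuffle sz) mcoeff0 => /eqP.
rewrite mulf_eq0 (negPf nz) /=; apply/negP.
by rewrite prodf_seq_neq0; apply/allP=> b _ /=; rewrite pivotE.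
Qed.

End DiagonalNichols.

Section ShuffleAlgebra.

Local Open Scope ring_scope.

Variables (k : fieldType) (A : eqType) (q : A -> A -> k).

Local Notation fn := (seq A -> k).
Local Notation L := (shuffle1 q).

Definition lincomb (x : k) (f : fn) (y : k) (g : fn) : fn :=
  fun u => x * f u + y * g u.

Definition skew_deriv (i : A) (f : fn) : fn := fun u => f (i :: u).

Definition vacuum : fn := shuffle q [::].

Local Notation d := skew_deriv.

Lemma skew_deriv_lincomb i x f y g :
  d i (lincomb x f y g) = lincomb x (d i f) y (d i g).
Proof. by []. Qed.

(** Together with linearity, this commutation rule is all that is needed to
    compute in the quantum shuffle algebra. *)
Lemma skew_deriv_shuffle1 i j f :
  d i (L j f) = lincomb (i == j)%:R f (q j i) (L j (d i f)).
Proof. exact: functional_extensionality. Qed.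

Lemma shuffle1_lincomb j x f y g :
  L j (lincomb x f y g) = lincomb x (L j f) y (L j g).
Proof.
apply: functional_extensionality => u; rewrite /lincomb.
elim: u f g => [|i u IH] f g /=; first by rewrite !mulr0 addr0.
rewrite (IH (d i f) (d i g)); ring.
Qed.

(** The degree n component of the subalgebra generated by the letters, which is
    the image of the quantum symmetrizer. *)
Definition in_shuffle_algebra (n : nat) (f : fn) : Prop :=
  exists2 s : seq (k * seq A), all (fun x => size x.2 == n) s &
    forall u, f u = \sum_(x <- s) x.1 * shuffle q x.2 u.

Lemma in_shuffle_vacuum : in_shuffle_algebra 0 vacuum.
Proof. by exists [:: (1, [::])] => // u; rewrite big_seq1 mul1r. Qed.

Lemma in_shuffle_lincomb n x f y g :
  in_shuffle_algebra n f -> in_shuffle_algebra n g ->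
  in_shuffle_algebra n (lincomb x f y g).
Proof.
move=> [s sn fE] [t tn gE].
exists ([seq (x * z.1, z.2) | z <- s] ++ [seq (y * z.1, z.2) | z <- t]).
  by rewrite all_cat !all_map; apply/andP.
move=> u; rewrite /lincomb fE gE big_cat !big_map !mulr_sumr.
by congr (_ + _); apply: eq_bigr => z _; rewrite mulrA.
Qed.

Lemma in_shuffle1 n j f :
  in_shuffle_algebra n f -> in_shuffle_algebra n.+1 (L j f).
Proof.
move=> [s sn fE]; exists [seq (z.1, j :: z.2) | z <- s].
  by rewrite all_map.
have -> : f = fun u => \sum_(x <- s) x.1 * shuffle q x.2 u.
  exact: functional_extensionality.
move=> u; rewrite big_map /=; elim: s {sn fE} => [|z s IH].
  rewrite big_nil; elim: u => //= i u IH; rewrite big_nil mulr0 add0r.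
  have -> : (fun v => \sum_(x <- [::]) x.1 * shuffle q x.2 (i :: v)) =
            (fun v => \sum_(x <- [::]) x.1 * shuffle q x.2 v) :> fn.
    by apply: functional_extensionality => v; rewrite !big_nil.
  by rewrite IH mulr0.
rewrite big_cons -IH.
have -> : (fun v => \sum_(x <- z :: s) x.1 * shuffle q x.2 v) =
    lincomb z.1 (shuffle q z.2)
            1 (fun v => \sum_(x <- s) x.1 * shuffle q x.2 v).
  by apply: functional_extensionality => v; rewrite big_cons /lincomb mul1r.
by rewrite shuffle1_lincomb /lincomb mul1r.
Qed.

Lemma in_shuffle_neq0 n f u : in_shuffle_algebra n f -> f u != 0 ->
  exists2 w, size w = n & shuffle q w u != 0.
Proof.
move=> [s /allP sn fE] nz.
have /hasP[x xs nzx] : has (fun x => x.1 * shuffle q x.2 u != 0) s.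
  apply: contraR nz => /hasPn h; rewrite fE big_seq big1 // => x /h.
  by rewrite negbK => /eqP.
exists x.2; first by apply/eqP/sn.
by apply: contraNneq nzx => ->; rewrite mulr0.
Qed.

(** Here [Z] is left multiplication by an element z, and removing the word [s]
    acts on the powers of z as a derivation with value [C] on z.  Hence z^n has
    the coefficient n! C^n at the n-fold repetition of [s]. *)
Lemma shuffle_unbounded_of_derivation (Z : fn -> fn) (s : seq A) (C : k) :
  [pchar k] =i pred0 -> C != 0 -> (0 < size s)%N ->
  (forall n f,
     in_shuffle_algebra n f -> in_shuffle_algebra (size s + n) (Z f)) ->
  (forall x f, Z (fun u => x * f u) = fun u => x * Z f u) ->
  (forall n, let f := iter n Z vacuum in
     (fun u => Z f (s ++ u)) =
     lincomb C f 1 (Z (fun u => f (s ++ u)))) ->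
  forall m, exists w u,
    [/\ size w = size u, (m < size u)%N & shuffle q w u != 0].
Proof.
move=> char0 nzC s_gt0 Zdeg Zscale Zder m; pose f n := iter n Z vacuum.
have {}Zder n : (fun u => f n.+1 (s ++ u)) =
    lincomb C (f n) 1 (Z (fun u => f n (s ++ u))) by exact: Zder.
have fder n : (fun u => f n.+1 (s ++ u)) = fun u => n.+1%:R * C * f n u.
  elim: n => [|n IH].
    rewrite Zder; apply: functional_extensionality => u; rewrite /lincomb.
    have -> : (fun u => f 0 (s ++ u)) = fun u => 0 * vacuum u.
      apply: functional_extensionality => v; rewrite mul0r.
      by case: (s) s_gt0.
    by rewrite Zscale mul0r mulr0 addr0 mul1r.
  rewrite Zder; apply: functional_extensionality => u; rewrite /lincomb.
  rewrite IH Zscale mul1r -[Z (f n) u]/(f n.+1 u) -[n.+2]add1n natrD.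
  by move: (f n.+1 u) => y; ring.
have [u szu nzu] : exists2 u, size u = (size s * m.+1)%N & f m.+1 u != 0.
  elim: (m.+1) => [|n [u szu nzu]].
    by exists [::]; rewrite ?muln0 //= oner_neq0.
  exists (s ++ u); first by rewrite size_cat szu mulnS.
  have -> : f n.+1 (s ++ u) = n.+1%:R * C * f n u.
    by rewrite -[LHS]/((fun u => f n.+1 (s ++ u)) u) fder.
  by have /pcharf0P nat0 := char0; rewrite !mulf_neq0 // nat0.
have [|w szw nzw] := @in_shuffle_neq0 (size s * m.+1) (f m.+1) u _ nzu.
  elim: (m.+1) => [|n IH]; first by rewrite muln0; apply: in_shuffle_vacuum.
  by rewrite mulnS; apply: Zdeg.
exists w, u; rewrite szw szu; split=> //; nia.
Qed.

Hypothesis char0 : [pchar k] =i pred0.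

Lemma shuffle_unbounded1 a : q a a = 1 ->
  forall m, exists w u,
    [/\ size w = size u, (m < size u)%N & shuffle q w u != 0].
Proof.
move=> qa; apply: (@shuffle_unbounded_of_derivation (L a) [:: a] 1) => //.
- exact: oner_neq0.
- by move=> n f; apply: in_shuffle1.
- move=> x f; have -> : (fun u => x * f u) = lincomb x f 0 f.
    by apply: functional_extensionality => u; rewrite /lincomb mul0r addr0.
  rewrite shuffle1_lincomb; apply: functional_extensionality => u.
  by rewrite /lincomb mul0r addr0.
move=> n /=; apply: functional_extensionality => u.
by rewrite /lincomb /= eqxx qa.
Qed.

(** The element z is the braided commutator of b and a.  The first hypothesis
    on q makes the degree of z braid trivially with itself, and the second one
    says that z does not vanish. *)
Lemma shuffle_unbounded2 a b : a != b ->
  q a a * q b b * (q a b * q b a) = 1 -> q a b * q b a != 1 ->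
  forall m, exists w u,
    [/\ size w = size u, (m < size u)%N & shuffle q w u != 0].
Proof.
move=> ab qab nz.
have ba : (b == a) = false by rewrite eq_sym (negPf ab).
pose Z f := lincomb 1 (L b (L a f)) (- q b a) (L a (L b f)).
have Zlin x f y g : Z (lincomb x f y g) = lincomb x (Z f) y (Z g).
  rewrite /Z !shuffle1_lincomb; apply: functional_extensionality => u.
  by rewrite /lincomb /=; ring.
have Zscale x f : Z (fun u => x * f u) = fun u => x * Z f u.
  have -> : (fun u => x * f u) = lincomb x f 0 f.
    by apply: functional_extensionality => u; rewrite /lincomb mul0r addr0.
  rewrite Zlin; apply: functional_extensionality => u.
  by rewrite /lincomb mul0r addr0.
have daZ f : d a (Z f) = fun u => q b a * q a a * Z (d a f) u.
  rewrite /Z skew_deriv_lincomb !(skew_deriv_shuffle1, shuffle1_lincomb)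
     eqxx (negPf ab).
  apply: functional_extensionality => u; rewrite /lincomb /=; ring.
have dbZ f : d b (Z f) = lincomb (1 - q a b * q b a) (L a f)
                                 (q a b * q b b) (Z (d b f)).
  rewrite /Z skew_deriv_lincomb !(skew_deriv_shuffle1, shuffle1_lincomb)
     eqxx ba.
  apply: functional_extensionality => u; rewrite /lincomb /=; ring.
apply: (@shuffle_unbounded_of_derivation Z [:: b; a] (1 - q a b * q b a)) => //.
- by rewrite subr_eq0 eq_sym.
- by move=> n f fn; apply: in_shuffle_lincomb; do 2!apply: in_shuffle1.
move=> n f.
have da0 : d a f = fun u => 0 * f u.
  rewrite /f; elim: (n) => [|n' IH].
    by apply: functional_extensionality => u; rewrite mul0r.
  rewrite [LHS]daZ IH; apply: functional_extensionality => u /=.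
  by rewrite Zscale !mul0r mulr0.
rewrite -[LHS]/(d a (d b (Z f))) dbZ skew_deriv_lincomb daZ skew_deriv_shuffle1.
rewrite da0 eqxx.
have -> : (fun u => 0 * f u) = lincomb 0 f 0 f.
  by apply: functional_extensionality => u; rewrite /lincomb mul0r addr0.
rewrite shuffle1_lincomb; apply: functional_extensionality => u.
rewrite /lincomb /=; move: (Z _ u) => z.
have -> : q a b * q b b * (q b a * q a a * z) =
    q a a * q b b * (q a b * q b a) * z by ring.
by rewrite qab; ring.
Qed.

(** The element z is the braided commutator of y with a, where y is that of c
    and b; it is annihilated by the skew derivations of a and b. *)
Lemma shuffle_unbounded3 a b c : a != b -> b != c -> a != c ->
  q a a * q b b * q c c *
    (q a b * q b a) * (q b c * q c b) * (q a c * q c a) = 1 ->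
  q b a != 0 -> q b c * q c b != 1 -> q a c * q c a != 1 ->
  forall m, exists w u,
    [/\ size w = size u, (m < size u)%N & shuffle q w u != 0].
Proof.
move=> ab bc ac qabc nz1 nz2 nz3.
have ba : (b == a) = false by rewrite eq_sym (negPf ab).
have cb : (c == b) = false by rewrite eq_sym (negPf bc).
have ca : (c == a) = false by rewrite eq_sym (negPf ac).
pose Y f := lincomb 1 (L c (L b f)) (- q c b) (L b (L c f)).
pose Z f := lincomb 1 (Y (L a f)) (- (q c a * q b a)) (L a (Y f)).
have Ylin x f y g : Y (lincomb x f y g) = lincomb x (Y f) y (Y g).
  rewrite /Y !shuffle1_lincomb; apply: functional_extensionality => u.
  by rewrite /lincomb /=; ring.
have Zlin x f y g : Z (lincomb x f y g) = lincomb x (Z f) y (Z g).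
  rewrite /Z !(shuffle1_lincomb, Ylin).
  by apply: functional_extensionality => u; rewrite /lincomb /=; ring.
have scaleE x f : (fun u => x * f u) = lincomb x f 0 f.
  by apply: functional_extensionality => u; rewrite /lincomb mul0r addr0.
have Zscale x f : Z (fun u => x * f u) = fun u => x * Z f u.
  by rewrite !scaleE Zlin.
have daY f : d a (Y f) = lincomb (q c a * q b a) (Y (d a f)) 0 f.
  rewrite /Y skew_deriv_lincomb !(skew_deriv_shuffle1, shuffle1_lincomb)
     (negPf ab) (negPf ac).
  apply: functional_extensionality => u; rewrite /lincomb /=; ring.
have dbY f : d b (Y f) = lincomb (q c b * q b b) (Y (d b f)) 0 f.
  rewrite /Y skew_deriv_lincomb !(skew_deriv_shuffle1, shuffle1_lincomb)
     eqxx (negPf bc).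
  apply: functional_extensionality => u; rewrite /lincomb /=; ring.
have dcY f : d c (Y f) = lincomb (1 - q b c * q c b) (L b f)
                                 (q b c * q c c) (Y (d c f)).
  rewrite /Y skew_deriv_lincomb !(skew_deriv_shuffle1, shuffle1_lincomb)
     eqxx cb.
  apply: functional_extensionality => u; rewrite /lincomb /=; ring.
have daZ f : d a (Z f) = lincomb (q c a * q b a * q a a) (Z (d a f)) 0 f.
  rewrite /Z skew_deriv_lincomb daY !skew_deriv_shuffle1 daY !Ylin !shuffle1_lincomb.
  rewrite eqxx; apply: functional_extensionality => u; rewrite /lincomb /=; ring.
have dbZ f : d b (Z f) = lincomb (q c b * q b b * q a b) (Z (d b f)) 0 f.
  rewrite /Z skew_deriv_lincomb dbY !skew_deriv_shuffle1 dbY !Ylin !shuffle1_lincomb.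
  rewrite ba; apply: functional_extensionality => u; rewrite /lincomb /=; ring.
have dcZ f : d c (Z f) = lincomb (1 - q b c * q c b)
    (lincomb 1 (L b (L a f)) (- (q c a * q b a * q a c)) (L a (L b f)))
    (q b c * q c c * q a c) (Z (d c f)).
  rewrite /Z skew_deriv_lincomb dcY !skew_deriv_shuffle1 dcY !Ylin !shuffle1_lincomb.
  rewrite ca; apply: functional_extensionality => u; rewrite /lincomb /=; ring.
pose C := (1 - q b c * q c b) * q b a * (1 - q a c * q c a).
have Zdeg n f : in_shuffle_algebra n f -> in_shuffle_algebra n.+3 (Z f).
  move=> fn; apply: in_shuffle_lincomb; last first.
    by apply: in_shuffle1; apply: in_shuffle_lincomb; do 2!apply: in_shuffle1.
  by apply: in_shuffle_lincomb; do 3!apply: in_shuffle1.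
clearbody Z; apply: (@shuffle_unbounded_of_derivation Z [:: c; a; b] C) => //.
  by rewrite !mulf_neq0 // subr_eq0 eq_sym.
move=> n f.
have d0 i : (i == a) || (i == b) -> d i f = lincomb 0 f 0 f.
  move=> iab; rewrite /f; elim: (n) => [|n' IH].
    by apply: functional_extensionality => u; rewrite /lincomb mul0r addr0.
  have [x ->] : exists x, d i (iter n'.+1 Z vacuum) =
      lincomb x (Z (d i (iter n' Z vacuum))) 0 (iter n' Z vacuum).
    by case/orP: iab => /eqP->; eexists; [apply: daZ | apply: dbZ].
  rewrite IH Zlin; apply: functional_extensionality => u.
  by rewrite /lincomb !mul0r !addr0 mulr0.
have d0a : d a f = lincomb 0 f 0 f by apply: d0; rewrite eqxx.
have d0b : d b f = lincomb 0 f 0 f by apply: d0; rewrite eqxx orbT.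
rewrite -[LHS]/(d b (d a (d c (Z f)))) dcZ; clearbody f.
rewrite !(skew_deriv_lincomb, skew_deriv_shuffle1, shuffle1_lincomb) daZ.
rewrite !(skew_deriv_lincomb, skew_deriv_shuffle1, shuffle1_lincomb) dbZ.
rewrite !(d0a, skew_deriv_lincomb, skew_deriv_shuffle1, shuffle1_lincomb).
rewrite !(d0b, skew_deriv_lincomb, skew_deriv_shuffle1, shuffle1_lincomb).
rewrite !eqxx ba (negPf ab).
apply: functional_extensionality => u; rewrite /lincomb /=.
move: (Z _ u) => z.
have -> : 1 * z = q a a * q b b * q c c *
    (q a b * q b a) * (q b c * q c b) * (q a c * q c a) * z.
  by rewrite qabc.
rewrite /C; ring.
Qed.

End ShuffleAlgebra.

(** * Diagonal braided subspaces of Yetter-Drinfeld modules *)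

Section Eigenvectors.

Local Open Scope ring_scope.

Variable k : closedFieldType.

Lemma row_eigenvector n (M : 'M[k]_n) : (0 < n)%N ->
  exists v : 'rV_n, exists2 x, v != 0 & v *m M = x *: v.
Proof.
move=> n_gt0; have /closed_rootP[x] : size (char_poly M) != 1%N.
  by rewrite size_char_poly; lia.
by rewrite -eigenvalue_root_char => /eigenvalueP[v]; exists v, x.
Qed.

(** An eigenspace of M is stable under N. *)
Lemma common_eigenvector n (M N : 'M[k]_n) : (0 < n)%N -> M *m N = N *m M ->
  exists v : 'cV_n, exists x y, [/\ v != 0, M *m v = x *: v & N *m v = y *: v].
Proof.
move=> n_gt0 MN; have [u [x u_neq0 uM]] := row_eigenvector M^T n_gt0.
pose W := row_base (eigenspace M^T x).
have WM : W *m M^T = x *: W by apply/eigenspaceP; rewrite eq_row_base.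
have sub : (W *m N^T <= W)%MS.
  rewrite eq_row_base; apply/eigenspaceP.
  by rewrite -mulmxA -trmx_mul MN trmx_mul mulmxA WM scalemxAl.
have r_gt0 : (0 < \rank (eigenspace M^T x))%N.
  rewrite lt0n mxrank_eq0; apply: contraNneq u_neq0 => E0.
  by have /eigenspaceP : u *m M^T = x *: u by []; rewrite E0 submx0.
have [w [y w_neq0 wD]] := row_eigenvector (W *m N^T *m pinvmx W) r_gt0.
exists (w *m W)^T, x, y; split.
- rewrite trmx_eq0; apply: contraNneq w_neq0 => wW0.
  by apply/eqP/(row_free_inj (row_base_free (eigenspace M^T x))); rewrite mul0mx.
- by rewrite -{1}[M]trmxK -trmx_mul -mulmxA WM -scalemxAr linearZ.
- rewrite -{1}[N]trmxK -trmx_mul -mulmxA -(mulmxKpV sub) mulmxA wD.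
  by rewrite -scalemxAl linearZ.
Qed.

End Eigenvectors.

Section YetterDrinfeldDiagonal.

Local Open Scope ring_scope.

Variables (k : closedFieldType) (gT : finGroupType) (G : {group gT}) (g : gT).
Variables (n : nat) (rho : mx_representation k 'C_G[g] n).
Hypothesis Gg : g \in G.

Lemma yd_tensorZ x a (v : 'cV[k]_n) :
  tensor1 (yd_tensor rho x (a *: v)) = a *: tensor1 (yd_tensor rho x v).
Proof.
rewrite /tensor1 scaler_sumr; apply: eq_bigr => p _.
rewrite !ffunE scalerA -scalemxAr mxE.
by case: ifP; rewrite ?mulr0 ?scale0r.
Qed.

(** The braiding moves x_b (x) v to x_a g x_a^-1 x_b (x) v, and
    x_a g x_a^-1 x_b = x_b h, where h is the conjugate of g by x_a^-1 x_b.  When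
    h centralizes g and v is an eigenvector of h, this is a multiple of
    x_b (x) v.  The vectors x_a (x) v are independent because they are supported
    by distinct cosets. *)
Lemma yd_diagonal_infinite (A : eqType) (a0 : A) (x : A -> gT)
    (q : A -> A -> k) (v : 'cV[k]_n) : v != 0 ->
  (forall a, x a \in G) ->
  (forall a b, (g ^ ((x a)^-1 * x b))%g \in 'C_G[g]%g /\
               rho (g ^ ((x a)^-1 * x b))%g *m v = q a b *: v) ->
  (forall a b, a != b -> ((x b)^-1 * x a)%g \notin 'C_G[g]%g) ->
  (forall m, exists w u, [/\ size w = size u, (m < size u)%N &
                             shuffle q w u != 0]) ->
  ~ nichols_finite_dim (yd_braiding rho).
Proof.
move=> nzv Gx diag sep; pose e a := yd_tensor rho (x a) v.
have memX a b : (x b \in (x a *: 'C_G[g])%g) = (a == b).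
  rewrite mem_lcoset; have [-> | ab] := eqVneq a b; first by rewrite mulVg group1.
  by apply/negbTE/sep; rewrite eq_sym.
have HX a : (x a *: 'C_G[g])%g \in lcosets 'C_G[g]%g G.
  by apply/lcosetsP; exists (x a).
have nz a : exists i, (rho ((repr (x a *: 'C_G[g]))^-1 * x a)%g *m v) i 0 != 0.
  apply/cV0Pn; set h := (_ * _)%g; have Hh : h \in 'C_G[g]%g.
    have /lcosetP[y Hy rE] : repr (x a *: 'C_G[g])%g \in (x a *: 'C_G[g])%g.
      by apply: (mem_repr (x a)); apply: (lcoset_refl 'C_G[g]%G).
    by rewrite /h rE invMg -mulgA mulVg mulg1 groupV.
  apply: contraNneq nzv => h0.
  by rewrite -[v](mulKmx (repr_mx_unit rho Hh)) h0 mulmx0.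
pose pivot a : yd_basis G g n :=
  (exist (fun X : {set gT} => X \in lcosets 'C_G[g]%g G) _ (HX a),
   xchoose (nz a)).
apply: (@nichols_infinite _ _ _ _ e q a0 pivot) => a b.
  rewrite /e yd_braidingE //; have [Hh hv] := diag a b.
  have -> : (x a * g * (x a)^-1 * x b = x b * g ^ ((x a)^-1 * x b))%g.
    by rewrite conjgE invMg invgK !mulgA mulgV mul1g.
  by rewrite yd_tensor_balanced // hv yd_tensorZ scalerAl.
rewrite /e ffunE /= memX [in RHS]eq_sym.
case: (b =P a) => [->|_]; last by rewrite eqxx.
exact: (xchooseP (nz a)).
Qed.

End YetterDrinfeldDiagonal.

Section Criteria.

Local Open Scope ring_scope.

Variables (k : closedFieldType) (gT : finGroupType) (G : {group gT}) (g : gT).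
Hypotheses (char0 : [pchar k] =i pred0) (Gg : g \in G).

Lemma cent_self : g \in 'C_G[g]%g.
Proof. by rewrite inE Gg cent1id. Qed.

Lemma yd_trivial_infinite n (rho : mx_representation k 'C_G[g] n) (v : 'cV_n) :
  v != 0 -> rho g *m v = v -> ~ nichols_finite_dim (yd_braiding rho).
Proof.
move=> nzv gv; apply: (@yd_diagonal_infinite _ _ _ _ _ rho Gg unit tt
  (fun=> 1%g) (fun _ _ => 1) v) => //.
  by move=> a b; rewrite mulVg conjg1 scale1r cent_self.
exact: (@shuffle_unbounded1 _ _ _ char0 tt).
Qed.

Lemma repr_eigen_exp n (rho : mx_representation k 'C_G[g] n) (v : 'cV_n) h a m :
  h \in 'C_G[g]%g -> rho h *m v = a *: v -> rho (h ^+ m)%g *m v = a ^+ m *: v.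
Proof.
move=> Hh hv; elim: m => [|m IH]; first by rewrite repr_mx1 mul1mx scale1r.
rewrite expgSr repr_mxM ?groupX // -mulmxA hv -scalemxAr IH scalerA.
by rewrite exprS.
Qed.

Lemma repr_eigen_mul n (rho : mx_representation k 'C_G[g] n) (v : 'cV_n) h h' a b :
  h \in 'C_G[g]%g -> h' \in 'C_G[g]%g ->
  rho h *m v = a *: v -> rho h' *m v = b *: v ->
  rho (h * h')%g *m v = (a * b) *: v.
Proof.
move=> Hh Hh' hv hv'.
by rewrite repr_mxM // -mulmxA hv' -scalemxAr hv scalerA mulrC.
Qed.

Lemma repr_eigen_inv n (rho : mx_representation k 'C_G[g] n) (v : 'cV_n) h a :
  h \in 'C_G[g]%g -> v != 0 ->
  rho h *m v = a *: v -> a != 0 /\ rho h^-1%g *m v = a^-1 *: v.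
Proof.
move=> Hh nzv hv; have a_neq0 : a != 0.
  apply: contraNneq nzv => a0; rewrite -[v](mulKmx (repr_mx_unit rho Hh)) hv a0.
  by rewrite scale0r mulmx0.
split=> //; rewrite repr_mxV //; apply: (scalerI a_neq0).
by rewrite scalemxAr -hv mulKmx ?repr_mx_unit // scalerA divff // scale1r.
Qed.

Lemma eigen_inj n (v : 'cV[k]_n) a b : v != 0 -> a *: v = b *: v -> a = b.
Proof.
move=> nzv /eqP; rewrite -subr_eq0 -scalerBl scaler_eq0 (negPf nzv) orbF.
by rewrite subr_eq0 => /eqP.
Qed.

(** Let x be the eigenvalue of g on v.  The vectors 1 (x) v and t (x) v have a
    braiding of affine Cartan type A_1^(1), with diagonal entries x and the
    other entries x^-1.  Since x has odd order, x^2 = 1 only if x = 1. *)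
Theorem class_typeB_real (t : gT) : t \in G -> (g ^ t = g^-1)%g -> odd #[g]%g ->
  class_typeB k G g.
Proof.
move=> Gt gt oddg n rho /mx_irrP[n_gt0 _].
have [v [x [_ [nzv gv _]]]] := common_eigenvector n_gt0 (erefl (rho g *m rho g)).
have Hg := cent_self.
have [x1 | x_neq1] := eqVneq x 1.
  by apply: (yd_trivial_infinite nzv); rewrite gv x1 scale1r.
have [x_neq0 gVv] := repr_eigen_inv Hg nzv gv.
have xg : x ^+ #[g]%g = 1.
  apply: (eigen_inj nzv); rewrite -(repr_eigen_exp _ Hg gv) expg_order.
  by rewrite repr_mx1 mul1mx scale1r.
have x2 : x ^+ 2 != 1.
  apply: contraNneq x_neq1 => x2; rewrite -xg -[#[g]%g]odd_double_half oddg.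
  by rewrite exprD -mul2n exprM x2 expr1n mulr1.
have gtV : (g ^ t^-1 = g^-1)%g.
  by rewrite -[in LHS](invgK g) -[in LHS]gt conjVg conjgK.
have t_cent : t \notin 'C_G[g]%g.
  rewrite inE Gt /=; apply: contra x2 => /cent1P tg.
  have : (g ^+ 2 = 1)%g.
    by rewrite expgS expg1 -{2}(invgK g) -gt conjgE -tg mulKg mulgV.
  move=> g2; apply/eqP/(eigen_inj nzv).
  by rewrite -(repr_eigen_exp _ Hg gv) g2 repr_mx1 mul1mx scale1r.
pose y (b : bool) : gT := if b then t else 1%g.
pose q (a b : bool) := if a == b then x else x^-1.
apply: (@yd_diagonal_infinite _ _ _ _ _ rho Gg bool true y q v) => //.
- by case; rewrite /y /= ?group1.
- move=> [] []; rewrite /y /q /= ?invg1 ?mulg1 ?mul1g ?mulVg ?conjg1 ?gt ?gtV //;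
    by split; rewrite ?groupV.
- by move=> [] [] //= _; rewrite ?invg1 ?mulg1 ?mul1g ?groupV.
apply: (@shuffle_unbounded2 _ _ q char0 true false) => //; rewrite /q /=.
  by rewrite mulrACA divff // mulr1.
by apply: contra x2 => /eqP xx; rewrite expr2 -invr_eq1 invfM xx.
Qed.

(** Let x be the eigenvalue of g on v.  The vectors 1 (x) v, t (x) v and
    t^2 (x) v have a braiding of affine Cartan type A_2^(1): its diagonal
    entries are x, and q_ij q_ji = x^-1 because g and its conjugates by t and t^2
    have product 1.  If t centralized g then g^3 = 1, hence g = 1 and x = 1; so for
    x != 1 the three cosets are distinct. *)
Theorem class_typeB_triple (t : gT) : t \in G ->
  commute g (g ^ t)%g -> (g * g ^ t * g ^ (t ^+ 2) = 1)%g -> coprime #[g]%g 3 ->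
  class_typeB k G g.
Proof.
move=> Gt cgt gtt cop n rho /mx_irrP[n_gt0 _].
have Hg := cent_self.
have Hgt : (g ^ t)%g \in 'C_G[g]%g by rewrite inE groupJ //; apply/cent1P.
have gt2 : (g ^ (t ^+ 2) = (g * g ^ t)^-1)%g.
  by rewrite -[LHS](mulKg (g * g ^ t)%g) gtt mulg1.
have Hgt2 : (g ^ (t ^+ 2))%g \in 'C_G[g]%g by rewrite gt2 groupV groupM.
have gt3 : (g ^ (t ^+ 3) = g)%g.
  have : ((g * g ^ t * g ^ (t ^+ 2)) ^ t = 1)%g by rewrite gtt conj1g.
  rewrite 2!conjMg -!conjgM -!expgSr -[(t * t)%g]/(t ^+ 2)%g.
  by move/(canRL (mulKg _)); rewrite mulg1 gt2 (invMg g) mulKVg invgK.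
have comm : rho g *m rho (g ^ t)%g = rho (g ^ t)%g *m rho g.
  by rewrite -!repr_mxM // cgt.
have [v [x [y [nzv gv gtv]]]] := common_eigenvector n_gt0 comm.
have [x1 | x_neq1] := eqVneq x 1.
  by apply: (yd_trivial_infinite nzv); rewrite gv x1 scale1r.
have [x_neq0 _] := repr_eigen_inv Hg nzv gv.
have [y_neq0 _] := repr_eigen_inv Hgt nzv gtv.
have [_ gt2v] :=
  repr_eigen_inv (groupM Hg Hgt) nzv (repr_eigen_mul Hg Hgt gv gtv).
rewrite -gt2 in gt2v.
have t_cent : t \notin 'C[g]%g.
  apply: contra x_neq1 => /cent1P tg; have gtg : (g ^ t = g)%g.
    by rewrite conjgE -tg mulKg.
  have : (g ^+ 3 = 1)%g.
    by rewrite -gtt conjgM !gtg !expgS expg0 mulg1 mulgA.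
  move/eqP; rewrite -order_dvdn => g3.
  have : #[g]%g == 1%N by rewrite -dvdn1 -(eqP cop) dvdn_gcd dvdnn.
  rewrite order_eq1 => /eqP g1; apply/eqP/(eigen_inj nzv).
  by rewrite -gv (congr1 (fun h => rho h) g1) repr_mx1 mul1mx scale1r.
have t2_cent : (t ^+ 2)%g \notin 'C[g]%g.
  apply: contra t_cent => t2; rewrite -(groupMr _ t2) -expgS.
  by apply/cent1P; rewrite /commute (conjgC g) gt3.
(* eigenvalues of the conjugates of g by t^i for i < 3; since t^3 centralizes
   g, the entry q a b only depends on b - a modulo 3 *)
pose chi (i : nat) := if i is 0 then x else if i is 1 then y else (x * y)^-1.
pose q (a b : 'I_3) := chi ((3 - a + b) %% 3)%N.
pose z (a : 'I_3) := (t ^+ a)%g.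
have chiP i : (i < 3)%N -> (g ^ (t ^+ i))%g \in 'C_G[g]%g /\
    rho (g ^ (t ^+ i))%g *m v = chi i *: v.
  by case: i => [|[|[|]]] // _; rewrite ?conjg1.
have gt3m m : (g ^ (t ^+ (m * 3)) = g)%g.
  elim: m => [|m IH]; first by rewrite conjg1.
  by rewrite mulSn expgD conjgM gt3.
have zE a b : (g ^ ((z a)^-1 * z b) = g ^ (t ^+ ((3 - a + b) %% 3)))%g.
  rewrite -[in LHS]gt3 -conjgM -{1}(subnK (ltnW (ltn_ord a))).
  rewrite [(t ^+ (_ + _))%g]expgD -mulgA mulKVg -expgD.
  by rewrite {1}(divn_eq (3 - a + b) 3) expgD conjgM gt3m.
apply: (@yd_diagonal_infinite _ _ _ _ _ rho Gg 'I_3 ord0 z q v) => //.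
- by move=> a; rewrite groupX.
- by move=> a b; rewrite zE; apply: chiP; rewrite ltn_mod.
- have sep (a b : nat) : (a < b)%N -> (b < 3)%N ->
      ((t ^+ a)^-1 * t ^+ b)%g \notin 'C[g]%g.
    move=> ab b3; rewrite -(subnK (ltnW ab)) addnC expgD mulKg.
    have : (0 < b - a < 3)%N.
      by rewrite subn_gt0 ab (leq_ltn_trans (leq_subr _ _)).
    by case: (b - a)%N => [|[|[|]]].
  move=> a b; rewrite -val_eqE neq_ltn inE negb_and => /orP[] ab.
    by rewrite -(groupV 'C[g]) invMg invgK sep ?orbT.
  by rewrite sep ?orbT.
apply: (@shuffle_unbounded3 _ _ q char0
          ord0 (@Ordinal 3 1 isT) (@Ordinal 3 2 isT)) => //.
- rewrite /q /=; field; by rewrite x_neq0 y_neq0.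
- by rewrite /q /= ?invr_eq0 ?mulf_neq0.
- by rewrite /q /= invfM mulrCA divff // mulr1 invr_eq1.
- by rewrite /q /= invfM -mulrA mulVf // mulr1 invr_eq1.
Qed.

End Criteria.

(** * Matrices of size three over the field with four elements *)

Section Matrix3.

Local Open Scope ring_scope.

Variable F : fieldType.

Definition mx3 (a b c d e f g h i : F) : 'M[F]_3 :=
  \matrix_(r < 3, s < 3)
    nth 0 (nth [::] [:: [:: a; b; c]; [:: d; e; f]; [:: g; h; i]] r) s.

Lemma mx3P (A : 'M[F]_3) :
  exists a b c d e f g h i, A = mx3 a b c d e f g h i.
Proof.
pose o k (lt_k : (k < 3)%N) := Ordinal lt_k.
pose a r s := A r s; exists (a (o 0 isT) (o 0 isT)), (a (o 0 isT) (o 1 isT)).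
exists (a (o 0 isT) (o 2 isT)), (a (o 1 isT) (o 0 isT)), (a (o 1 isT) (o 1 isT)).
exists (a (o 1 isT) (o 2 isT)), (a (o 2 isT) (o 0 isT)), (a (o 2 isT) (o 1 isT)).
exists (a (o 2 isT) (o 2 isT)).
by apply/matrixP=> -[[|[|[|]]] //= ?] -[[|[|[|]]] //= ?]; rewrite mxE /=;
  congr (A _ _); apply: val_inj.
Qed.

Lemma mx3M a b c d e f g h i a' b' c' d' e' f' g' h' i' :
  mx3 a b c d e f g h i * mx3 a' b' c' d' e' f' g' h' i' =
  mx3 (a * a' + b * d' + c * g') (a * b' + b * e' + c * h')
      (a * c' + b * f' + c * i') (d * a' + e * d' + f * g')
      (d * b' + e * e' + f * h') (d * c' + e * f' + f * i')
      (g * a' + h * d' + i * g') (g * b' + h * e' + i * h')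
      (g * c' + h * f' + i * i').
Proof.
apply/matrixP=> -[[|[|[|]]] //= ?] -[[|[|[|]]] //= ?];
  by rewrite !mxE !big_ord_recl big_ord0 !mxE /= addr0 addrA.
Qed.

Lemma det_mx3 a b c d e f g h i :
  \det (mx3 a b c d e f g h i) =
  a * (e * i - f * h) - b * (d * i - f * g) + c * (d * h - e * g).
Proof.
rewrite (expand_det_row _ ord0) !big_ord_recl big_ord0 /cofactor.
rewrite !(expand_det_row _ ord0) !big_ord_recl !big_ord0 /cofactor !det_mx11 !mxE /=.
rewrite /bump /= !expr0 ?expr1; ring.
Qed.

Lemma mx3_1 : 1 = mx3 1 0 0 0 1 0 0 0 1.
Proof.
by apply/matrixP=> -[[|[|[|]]] //= ?] -[[|[|[|]]] //= ?]; rewrite !mxE.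
Qed.

Lemma eq_mx3 a b c d e f g h i a' b' c' d' e' f' g' h' i' :
  a = a' -> b = b' -> c = c' -> d = d' -> e = e' -> f = f' ->
  g = g' -> h = h' -> i = i' ->
  mx3 a b c d e f g h i = mx3 a' b' c' d' e' f' g' h' i'.
Proof. by do 9!move->. Qed.

Definition inverts (A T : 'M[F]_3) := A * T * A = T.

(** Here A1 and A2 are the conjugates of A by T and by T^2. *)
Definition triples (A T : 'M[F]_3) := exists A1 A2,
  [/\ A * T = T * A1, A1 * T = T * A2, A * A1 * A2 = 1 & A * A1 = A1 * A].

(** Matrix form of the two criteria on group elements.  The exponents 15 and 28
    are common multiples of the orders that occur, namely 3 and 5 in the
    first case, and 1, 2, 4 and 7 in the second one. *)
Definition tamed (A T : 'M[F]_3) :=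
  (inverts A T /\ A ^+ 15 = 1) \/ (triples A T /\ A ^+ 28 = 1).

Lemma tamed_conj (A T M : 'M[F]_3) : M \is a GRing.unit ->
  tamed A T -> tamed (M^-1 * A * M) (M^-1 * T * M).
Proof.
move=> uM; have cM X Y : (M^-1 * X * M) * (M^-1 * Y * M) = M^-1 * (X * Y) * M.
  by rewrite !mulrA mulrK.
have cX X n : (M^-1 * X * M) ^+ n = M^-1 * X ^+ n * M.
  elim: n => [|n IH]; first by rewrite !expr0 mulr1 mulVr.
  by rewrite !exprS IH cM.
have c1 : M^-1 * 1 * M = 1 by rewrite mulr1 mulVr.
case=> -[inv ord]; [left | right]; rewrite cX ord c1; split=> //.
  by rewrite /inverts !cM inv.
case: inv => A1 [A2 [h1 h2 h3 h4]]; exists (M^-1 * A1 * M), (M^-1 * A2 * M).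
by rewrite !cM h1 h2 h3 h4.
Qed.

(** Conjugation by the diagonal matrix multiplies the two entries next to the
    diagonal by w^2 and the corner entry by w.  Since these factors of a and b
    agree, A commutes with its conjugates, and 1 + w + w^2 = 0 makes the product
    of the three conjugates trivial. *)
Lemma triples_unitriangular (w a b c : F) : w ^+ 2 = - 1 - w ->
  triples (mx3 1 0 0 a 1 0 c b 1) (mx3 1 0 0 0 w 0 0 0 (- 1 - w)).
Proof.
move=> hw; exists (mx3 1 0 0 (a * (- 1 - w)) 1 0 (c * w) (b * (- 1 - w)) 1).
exists (mx3 1 0 0 (a * w) 1 0 (c * (- 1 - w)) (b * w) 1).
split; rewrite ?mx3_1 !mx3M; apply: eq_mx3; ring: hw.
Qed.

Lemma unitriangular_exp (a b c : F) n : mx3 1 0 0 a 1 0 c b 1 ^+ n =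
  mx3 1 0 0 (a *+ n) 1 0 (c *+ n + a * b *+ 'C(n, 2)) (b *+ n) 1.
Proof.
elim: n => [|n IH]; first by rewrite expr0 mx3_1 bin0n /= !mulr0n addr0.
rewrite exprS IH mx3M binS bin1 !mulrnDr !mulrS; apply: eq_mx3; ring.
Qed.

End Matrix3.

Section F4.

Local Open Scope ring_scope.

Variable F : finFieldType.
Hypothesis hF : #|F| = 4%N.

Lemma F4_pchar2 : 2%N \in [pchar F].
Proof. exact: (@card_finPcharP F 2 2). Qed.

Lemma F4_double (x : F) : x + x = 0.
Proof. exact: addrr_pchar2 F4_pchar2 x. Qed.

(** Reduces an identity in characteristic 2 to one that holds in every
    commutative ring. *)
Lemma F4_eq (x y z : F) : x - y = z + z -> x = y.
Proof. by rewrite F4_double => /subr0_eq. Qed.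

Lemma F4_opp1 : -1 = 1 :> F.
Proof. by apply: (@F4_eq _ _ (-1)); ring. Qed.

Lemma F4_exp4 (x : F) : x ^+ 4 = x.
Proof. by rewrite -hF expf_card. Qed.

Lemma F4_cube (x : F) : x != 0 -> x ^+ 3 = 1.
Proof. by move=> nz; apply: (mulfI nz); rewrite -exprS F4_exp4 mulr1. Qed.

Lemma F4_omega : exists w : F, w ^+ 2 = - 1 - w.
Proof.
have /existsP[w /andP[w0 w1]] : [exists w : F, (w != 0) && (w != 1)].
  rewrite -[[exists _, _]]negbK negb_exists; apply/negP=> /forallP all01.
  have : (#|F| <= size [:: 0%R : F; 1%R])%N.
    rewrite cardE; apply: uniq_leq_size (enum_uniq _) _ => w _.
    by have := all01 w; rewrite !inE negb_and !negbK.
  by rewrite hF.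
have w10 : w - 1 != 0 by rewrite subr_eq0.
exists w; apply/eqP; rewrite -subr_eq0 -(mulrI_eq0 _ (mulfI w10)); apply/eqP.
by transitivity (w ^+ 3 - 1); [ring | rewrite F4_cube // subrr].
Qed.

(** The witness T must in addition preserve the line of p, so as to stay in the
    stabilizer of the corresponding point of the projective plane. *)
Definition tamed_at (p : 'rV[F]_3) (A : 'M[F]_3) := exists T,
  [/\ \det T = 1, exists2 s, s != 0 & p *m T = s *: p & tamed A T].

Definition e0 : 'rV[F]_3 := delta_mx 0 0.

Lemma tamed_at_conj p s (A M : 'M[F]_3) : M \is a GRing.unit -> s != 0 ->
  tamed_at p A -> tamed_at (s *: (p *m M)) (M^-1 * A * M).
Proof.
move=> uM nzs [T [dT [r nzr pT] tA]]; exists (M^-1 * T * M); split.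
- by rewrite !det_mulmx det_inv dT mulr1 mulVr // -unitmxE.
- exists r => //; rewrite -scalemxAl -mulmxA.
  have -> : M *m (M^-1 * T * M) = T *m M :> 'M_3.
    by rewrite -[LHS]/(M * (M^-1 * T * M)) !mulrA mulrV ?mul1r.
  by rewrite mulmxA pT -scalemxAl !scalerA mulrC.
exact: tamed_conj.
Qed.

Lemma e0_mx3 t d e f g h i : e0 *m mx3 t 0 0 d e f g h i = t *: e0.
Proof.
rewrite -rowE; apply/rowP=> -[[|[|[|]]] //= ?]; rewrite !mxE /=; ring.
Qed.

Lemma tamed_unitriangular a b c : tamed_at e0 (mx3 1 0 0 a 1 0 c b 1).
Proof.
have [w hw] := F4_omega; exists (mx3 1 0 0 0 w 0 0 0 (- 1 - w)); split.
- rewrite det_mx3; ring: hw.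
- by exists 1; rewrite ?oner_neq0 // e0_mx3.
right; split; first exact: triples_unitriangular.
have even (x : F) n : x *+ (2 * n) = 0 by rewrite mulrnA mulr2n F4_double mul0rn.
rewrite unitriangular_exp mx3_1 (even _ 14) (even _ 14) (even _ 14).
by rewrite (_ : 'C(28, 2) = (2 * 189)%N) // even add0r.
Qed.

(** Let B be the block a, b, c, d.  If S and S B have trace 0, the
    Cayley-Hamilton theorem gives B S B = det(B) S = S, so that S conjugates B
    to its inverse.  The condition on the trace of B excludes trace 0, since 2 = 0;
    a nonzero trace is a cube root of unity, which yields B^15 = 1. *)
Lemma tamed_block (a b c d : F) : a * d - b * c = 1 -> a + d != 2%:R ->
  tamed_at e0 (mx3 1 0 0 0 a b 0 c d).
Proof.
move=> det1 trace.
have [x [y [z [trS detS]]]] : exists x y z : F,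
    x * (a - d) + y * c + z * b = 0 /\ - (x ^+ 2 + y * z) = 1.
  have [c0 | c_neq0] := eqVneq c 0.
    have [b0 | b_neq0] := eqVneq b 0.
      by exists 0, 1, (-1); rewrite b0 c0; split; ring.
    exists 1, 0, ((d - a) / b); rewrite c0; split; first by field.
    by rewrite mul0r addr0 expr1n F4_opp1.
  exists 1, ((d - a) / c), 0; split; first by field.
  by rewrite mulr0 addr0 expr1n F4_opp1.
exists (mx3 1 0 0 0 x y 0 z (- x)); split.
- rewrite det_mx3 -[RHS]detS; ring.
- by exists 1; rewrite ?oner_neq0 // e0_mx3.
left; split.
  rewrite /inverts !mx3M.
  have comb (u v : F) r : u - v = (x * (a - d) + y * c + z * b) * r -> u = v.
    by rewrite trS mul0r => /subr0_eq.
  have scl (u : F) : u = (a * d - b * c) * u by rewrite det1 mul1r.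
  apply: eq_mx3; try ring.
  - by rewrite [RHS]scl; apply: (comb _ _ a); ring.
  - by rewrite [RHS]scl; apply: (comb _ _ b); ring.
  - by rewrite [RHS]scl; apply: (comb _ _ c); ring.
  - by rewrite [RHS]scl; apply: (comb _ _ d); ring.
(* P x y is the block matrix of 1 and x B + y, and B^2 = t B - 1 *)
pose t := a + d.
pose P x y := mx3 1 0 0 0 (x * a + y) (x * b) 0 (x * c) (x * d + y).
have PM x1 y1 x2 y2 : P x1 y1 * P x2 y2 =
    P (x1 * x2 * t + x1 * y2 + x2 * y1) (y1 * y2 - x1 * x2).
  have ad : a * d = 1 + b * c by rewrite -det1; ring.
  rewrite /P mx3M /t; apply: eq_mx3; ring: ad.
have -> : mx3 1 0 0 0 a b 0 c d = P 1 0 by apply: eq_mx3; ring.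
have nzt : t != 0.
  apply: contra trace => /eqP; rewrite /t => ->.
  by apply/eqP/(@F4_eq _ _ (-1)); ring.
have t3 := F4_cube nzt.
(* B^5 = e B + 1, where e is idempotent and e t = e because t^3 = 1 *)
pose e := 1 + t + t ^+ 2.
have et : e * t = e by rewrite /e; ring: t3.
have e2 : e ^+ 2 = e.
  apply: (@F4_eq _ _ e); have -> : e ^+ 2 = e + e * t + e * t * t.
    by rewrite -[e ^+ 2]/(e * (1 + t + t ^+ 2)); ring.
  by rewrite !et; ring.
have P2 : P 1 0 ^+ 2 = P t (-1) by rewrite expr2 PM; congr P; ring.
have P4 : P 1 0 ^+ 4 = P 1 (1 + t ^+ 2).
  rewrite (exprM _ 2 2) P2 expr2 PM; congr P; last first.
    by apply: (@F4_eq _ _ (- t ^+ 2)); ring.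
  apply: (@F4_eq _ _ (- t)); ring: t3.
have P5 : P 1 0 ^+ 5 = P e 1.
  rewrite exprS P4 PM; congr P; first by rewrite /e; ring.
  by rewrite -F4_opp1; ring.
have P10 : P e 1 ^+ 2 = P e (1 + e).
  rewrite expr2 PM; congr P.
    have -> : e * e * t = e * e by rewrite -mulrA et.
    rewrite -(expr2 e) e2; apply: (@F4_eq _ _ e); ring.
  by rewrite -(expr2 e) e2 mulr1; apply: (@F4_eq _ _ (- e)); ring.
rewrite (exprM _ 5 3) P5 exprS P10 PM mx3_1 /P.
have -> : e * e * t + e * (1 + e) + e * 1 = 0.
  have -> : e * e * t = e * e by rewrite -mulrA et.
  by apply: (@F4_eq _ _ (e ^+ 2 + e)); ring.
have -> : 1 * (1 + e) - e * e = 1 by rewrite -(expr2 e) e2; ring.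
by apply: eq_mx3; ring.
Qed.

Lemma mx3_unit (a b c d e f g h i : F) :
  a * (e * i - f * h) - b * (d * i - f * g) + c * (d * h - e * g) != 0 ->
  mx3 a b c d e f g h i \is a GRing.unit.
Proof. by rewrite -det_mx3 -unitfE -unitmxE. Qed.

Lemma conj_of_intertwine (A B M : 'M[F]_3) : M \is a GRing.unit ->
  M * A = B * M -> A = M^-1 * B * M.
Proof. by move=> uM MA; rewrite -mulrA -MA mulKr. Qed.

(** Since ad - bc = 1, the block B of entries a, b, c, d satisfies
    det(1 - B) = 2 - tr B.  If this is nonzero, a change of basis clears the
    first column.  Otherwise B has a fixed row vector, and a basis that contains it
    makes the matrix lower unitriangular. *)
Lemma tamed_e0 (c1 a b c2 c d : F) : a * d - b * c = 1 ->
  tamed_at e0 (mx3 1 0 0 c1 a b c2 c d).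
Proof.
move=> det1; have e0E x y z t u v : e0 = 1 *: (e0 *m mx3 1 0 0 x y z t u v).
  by rewrite e0_mx3 !scale1r.
have ad : a * d = 1 + b * c by rewrite -det1; ring.
have [tr2 | tr] := eqVneq (a + d) 2%:R; last first.
  pose r := 2%:R - (a + d).
  have nzr : r != 0 by rewrite subr_eq0 eq_sym.
  (* the solution of (B - 1) (x, y) = (c1, c2), by Cramer's rule *)
  pose x := ((d - 1) * c1 - b * c2) / r; pose y := ((a - 1) * c2 - c * c1) / r.
  have xr : x * r = (d - 1) * c1 - b * c2 by rewrite mulfVK.
  have yr : y * r = (a - 1) * c2 - c * c1 by rewrite mulfVK.
  have uM : mx3 1 0 0 x 1 0 y 0 1 \is a GRing.unit.
    by apply: mx3_unit; rewrite !(mul0r, mulr0, subr0, addr0, mul1r, oner_neq0).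
  rewrite (@conj_of_intertwine (mx3 1 0 0 c1 a b c2 c d)
             (mx3 1 0 0 0 a b 0 c d) _ uM).
    rewrite [e0](e0E x 1 0 y 0 1); apply: tamed_at_conj => //.
      exact: oner_neq0.
    exact: tamed_block.
  rewrite !mx3M; apply: eq_mx3; try ring; apply: (mulIf nzr).
    have -> : (x * 1 + 1 * c1 + 0 * c2) * r = x * r + c1 * r by ring.
    have -> : (0 * 1 + a * x + b * y) * r = a * (x * r) + b * (y * r) by ring.
    rewrite xr yr /r; ring: ad.
  have -> : (y * 1 + 0 * c1 + 1 * c2) * r = y * r + c2 * r by ring.
  have -> : (0 * 1 + c * x + d * y) * r = c * (x * r) + d * (y * r) by ring.
  rewrite xr yr /r; ring: ad.
have dE : d = 2%:R - a by rewrite -tr2; ring.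
have [c0 | c_neq0] := eqVneq c 0; last first.
  (* for a + d = 2 the row vector (c, d - 1) is fixed by B *)
  have uM : mx3 1 0 0 0 c (d - 1) 0 0 1 \is a GRing.unit.
    by apply: mx3_unit; rewrite !(mul0r, mulr0, subr0, addr0, mul1r, mulr1).
  rewrite (@conj_of_intertwine (mx3 1 0 0 c1 a b c2 c d)
             (mx3 1 0 0 (c * c1 + (d - 1) * c2) 1 0 c2 1 1) _ uM).
    rewrite [e0](e0E 0 c (d - 1) 0 0 1); apply: tamed_at_conj => //.
      exact: oner_neq0.
    exact: tamed_unitriangular.
  have bc : b * c = a * d - 1 by rewrite -det1; ring.
  by rewrite !mx3M; apply: eq_mx3; rewrite ?dE in bc *; ring: bc.
have a1 : a = 1.
  apply/eqP; rewrite -subr_eq0; have : (a - 1) ^+ 2 == 0.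
    have -> : (a - 1) ^+ 2 = 1 - (a * d - b * c) by rewrite c0 dE; ring.
    by rewrite det1 subrr.
  by rewrite expf_eq0.
have uM : mx3 1 0 0 0 0 1 0 1 0 \is a @GRing.unit 'M[F]_3.
  apply: mx3_unit; rewrite !(mul0r, mulr0, subr0, addr0, mul1r, sub0r).
  by rewrite oppr_eq0 oner_neq0.
rewrite (@conj_of_intertwine (mx3 1 0 0 c1 a b c2 c d)
           (mx3 1 0 0 c2 1 0 c1 b 1) _ uM).
  rewrite [e0](e0E 0 0 1 0 1 0); apply: tamed_at_conj => //.
    exact: oner_neq0.
  exact: tamed_unitriangular.
by rewrite !mx3M dE c0 a1; apply: eq_mx3; ring.
Qed.

Theorem tamed_of_fixed (p : 'rV[F]_3) (A : 'M[F]_3) :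
  \det A = 1 -> p != 0 -> p *m A = p -> tamed_at p A.
Proof.
move=> dA nzp pA; pose M := row_ebase p.
have uM : M \is a GRing.unit by apply: row_ebase_unit.
pose s := col_ebase p 0 0.
have pE : p = s *: (e0 *m M).
  rewrite -{1}[p]mulmx_ebase [col_ebase p]mx11_scalar mul_scalar_mx -scalemxAl.
  congr (_ *: (_ *m _)); apply/rowP=> j; rewrite !mxE rank_rV nzp.
  by case: j => -[|j].
have nzs : s != 0 by apply: contraNneq nzp => s0; rewrite pE s0 scale0r.
have AE : A = M^-1 * (M * A * M^-1) * M by rewrite !mulrA mulVr // mul1r mulrVK.
set B := M * A * M^-1 in AE.
have dB : \det B = 1.
  by rewrite !det_mulmx det_inv dA mulr1 mulrV // -unitmxE.
have eB : e0 *m B = e0.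
  have MA : e0 *m M *m A = e0 *m M.
    by apply: (scalerI nzs); rewrite scalemxAl -pE pA.
  rewrite -[B]/(M *m A *m M^-1) !mulmxA MA -mulmxA.
  by rewrite -[M *m M^-1]/(M * M^-1) mulrV // mulmx1.
rewrite pE AE; apply: tamed_at_conj => //.
have [b00 [b01 [b02 [b10 [b11 [b12 [b20 [b21 [b22 BE]]]]]]]]] := mx3P B.
move: dB eB; rewrite BE -rowE => dB /rowP eB.
have := eB (@Ordinal 3 0 isT); rewrite !mxE /= => h0.
have := eB (@Ordinal 3 1 isT); rewrite !mxE /= => h1.
have := eB (@Ordinal 3 2 isT); rewrite !mxE /= => h2.
rewrite h0 h1 h2; apply: tamed_e0; rewrite -dB det_mx3 h0 h1 h2; ring.
Qed.

Section Irreducible.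

Variable A : 'M[F]_3.
Hypothesis dA : \det A = 1.
Hypothesis noeig : forall x, ~~ eigenvalue A x.

Let chi := char_poly A.

Lemma chi_noroot x : ~~ root chi x.
Proof. by rewrite -eigenvalue_root_char. Qed.

Lemma size_chi : size chi = 4%N.
Proof. exact: size_char_poly. Qed.

Definition krylov : 'M[F]_3 := \matrix_(i < 3) (e0 *m A ^+ i).

(** A cubic polynomial without roots is irreducible, so that the characteristic
    polynomial of A is coprime to every nonzero polynomial of degree at most 2;
    the latter therefore take invertible values at A. *)
Lemma krylov_unit : krylov \is a GRing.unit.
Proof.
suff : row_free krylov by rewrite row_free_unit.
apply: inj_row_free => u; rewrite mulmx_sum_row.
under eq_bigr do rewrite rowK scalemxAr.
rewrite -mulmx_sumr => uK.
have hp : horner_mx A (rVpoly u) = \sum_i u 0 i *: A ^+ i.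
  rewrite horner_rVpoly mulmx_sum_row linear_sum; apply: eq_bigr => i _.
  by rewrite rowK linearZ /= mxvecK.
apply/eqP; rewrite -[u]rVpolyK; apply: contraT => nzu.
have nzp : rVpoly u != 0 by apply: contraNneq nzu => ->; rewrite linear0.
have : coprimep chi (rVpoly u).
  rewrite irreducible_poly_coprime; last first.
    by apply: cubic_irreducible; rewrite ?size_chi //; apply: chi_noroot.
  apply: contraL (size_poly 3 (fun i => if insub i is Some j then u 0 j else 0)).
  move/(dvdp_leq nzp); rewrite size_chi -ltnNge => h; apply: leq_trans h _.
  by rewrite /rVpoly.
case/Bezout_eq1_coprimepP=> -[u1 u2] /= /(congr1 (horner_mx A)).
rewrite [u2 * _]mulrC rmorphD !rmorphM rmorph1 /= [horner_mx A chi]Cayley_Hamilton.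
rewrite mulr0 add0r hp.
move/(congr1 (mulmx e0)); rewrite mulmxA uK mul0mx mulmx1 => /rowP/(_ 0).
by rewrite !mxE /= => /eqP; rewrite eq_sym oner_eq0.
Qed.

Lemma cube_relation : exists a b : F,
  [/\ A ^+ 3 = a *: A ^+ 2 + b *: A + 1 &
      forall x, x ^+ 3 + a * x ^+ 2 + b * x + 1 != 0].
Proof.
have c3 : chi`_3 = 1.
  by have /monicP := char_poly_monic A; rewrite /lead_coef size_char_poly.
have c0 : chi`_0 = 1.
  by rewrite char_poly_det dA mulr1 F4_opp1 expr1n.
have opp (B : 'M[F]_3) : - B = B by rewrite -scaleN1r F4_opp1 scale1r.
exists chi`_2, chi`_1; split; last first.
  move=> x; have := chi_noroot x; rewrite /root horner_coef size_chi.
  rewrite !big_ord_recl big_ord0 /= c0 c3; apply: contraNneq => e.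
  apply/eqP; rewrite -[RHS]e /bump /=; ring.
have chiE : chi = 1 + (chi`_1 *: 'X + (chi`_2 *: 'X^2 + 'X^3)).
  rewrite -[LHS]coefK size_chi poly_def !big_ord_recl big_ord0 /= addr0 c3 c0.
  by rewrite !scale1r expr0 expr1.
move: chiE; set a := chi`_2; set b := chi`_1 => chiE.
have := Cayley_Hamilton A; rewrite -/chi chiE !rmorphD rmorph1 /= !linearZ /=.
rewrite !rmorphXn /= horner_mx_X => /eqP; rewrite !addrA addr_eq0 eq_sym opp.
by move/eqP->; rewrite addrC addrA addrAC.
Qed.

End Irreducible.

(** The successive conjugates of A by T are A^2 and A^4, and 1 + 2 + 4 = 7. *)
Lemma tamed_frobenius (A T : 'M[F]_3) :
  A * T = T * A ^+ 2 -> A ^+ 7 = 1 -> tamed A T.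
Proof.
move=> AT A7; right; split; last by rewrite (exprM _ 7 4) A7 expr1n.
exists (A ^+ 2), (A ^+ 4); split=> //.
- by rewrite expr2 -mulrA AT mulrA AT -mulrA -expr2 -exprM.
- by rewrite -exprS -exprD.
by rewrite -exprS -exprSr.
Qed.

Lemma krylov_companion (A : 'M[F]_3) (b c : F) :
  A ^+ 3 = c *: A ^+ 2 + b *: A + 1 ->
  krylov A * A = mx3 0 1 0 0 0 1 1 b c * krylov A.
Proof.
move=> A3; apply/row_matrixP=> i; rewrite -[krylov A * A]/(krylov A *m A).
rewrite -[mx3 _ _ _ _ _ _ _ _ _ * _]/(mx3 _ _ _ _ _ _ _ _ _ *m krylov A).
rewrite !row_mul [RHS]mulmx_sum_row !big_ord_recl big_ord0 !rowK -mulmxA.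
rewrite -[A ^+ i *m A]/(A ^+ i * A) -exprSr !mxE addr0.
case: i => [[|[|[|i]]] //= ?]; rewrite /bump /=.
- by rewrite !scale0r scale1r add0r addr0.
- by rewrite !scale0r scale1r !add0r.
rewrite A3 scale1r !mulmxDr -!scalemxAr addrC; congr (_ + _).
by rewrite addrC expr1.
Qed.

(** Proves the equality of two numerals whose difference is 2 m or - 2 m for
    some m in the given range. *)
Ltac parity m n :=
  lazymatch n with
  | 0%N => fail
  | S ?n' => first [by apply: (@F4_eq _ _ m%:R); ring
                   | by apply: (@F4_eq _ _ (- m%:R)); ring | parity (S m) n']
  end.

(** The cubic polynomial has its coefficients in the field with two elements, so
    A^2 is a root of it as well.  In the basis formed by the vectors e0 A^i, the
    matrix T describes the linear map that sends e0 p(A) to e0 p(A^2). *)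
Lemma tamed_cubic (A : 'M[F]_3) (b c : F) :
  (forall x, ~~ eigenvalue A x) ->
  A ^+ 3 = c *: A ^+ 2 + b *: A + 1 ->
  (b = 1 /\ c = 0) \/ (b = 0 /\ c = 1) ->
  exists2 T, \det T = 1 & tamed A T.
Proof.
move=> noeig A3 bc; have uM := krylov_unit noeig; set M := krylov A in uM.
rewrite (conj_of_intertwine uM (krylov_companion A3)).
have conj T : \det T = 1 -> \det (M^-1 * T * M) = 1.
  by move=> dT; rewrite !det_mulmx det_inv dT mulr1 mulVr // -unitmxE.
set C := mx3 _ _ _ _ _ _ _ _ _.
suff [T dT tC] : exists2 T, \det T = 1 & C * T = T * C ^+ 2 /\ C ^+ 7 = 1.
  exists (M^-1 * T * M); first exact: conj.
  by apply: tamed_conj => //; apply: tamed_frobenius; case: tC.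
have C7 : C ^+ 7 = C * (C * C) * ((C * C) * (C * C)).
  by rewrite -!expr2 -exprM -exprS -exprD.
rewrite C7 expr2; case: bc => -[bE cE]; rewrite /C bE cE.
  exists (mx3 1 0 0 0 0 1 0 1 1).
    by rewrite det_mx3; apply: (@F4_eq _ _ (-1)); ring.
  split; rewrite ?mx3_1 !mx3M; apply: eq_mx3;
    parity 0%N 9%N.
exists (mx3 1 0 0 0 0 1 1 1 1).
  by rewrite det_mx3; apply: (@F4_eq _ _ (-1)); ring.
split; rewrite ?mx3_1 !mx3M; apply: eq_mx3;
  parity 0%N 9%N.
Qed.

(** The polynomial x^3 + a x^2 + b x + 1 has no root only if one of a and b is
    zero: otherwise - b / a has cube 1 and is a root.  Scaling A then turns the
    other coefficient into 1. *)
Theorem tamed_of_irreducible (A : 'M[F]_3) :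
  \det A = 1 -> (forall x, ~~ eigenvalue A x) ->
  exists2 m, m != 0 & exists2 T, \det T = 1 & tamed (m *: A) T.
Proof.
move=> dA noeig; have [a [b [A3 noroot]]] := cube_relation dA noeig.
have eigZ m : m != 0 -> forall x, ~~ eigenvalue (m *: A) x.
  move=> nzm x; apply: contra (noeig (x / m)) => /eigenvalueP[v vA nzv].
  apply/eigenvalueP; exists v => //; apply: (scalerI nzm).
  by rewrite scalerA mulrCA divff // mulr1 -vA -scalemxAr.
have [a0 | nza] := eqVneq a 0.
  have nzb : b != 0.
    apply: contraNneq (noroot 1) => ->; rewrite a0; apply/eqP/(@F4_eq _ _ 1).
    by ring.
  exists b => //; apply: (@tamed_cubic _ 1 0); [exact: eigZ | | by left].
  by rewrite exprZn F4_cube // !scale1r scale0r add0r A3 a0 scale0r add0r.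
have b0 : b = 0.
  apply: contraTeq (noroot (- b / a)) => nzb; rewrite negbK.
  rewrite F4_cube ?mulf_neq0 ?oppr_eq0 ?invr_eq0 //; apply/eqP/(@F4_eq _ _ 1).
  by field.
exists (a ^+ 2); first by rewrite expf_neq0.
apply: (@tamed_cubic _ 0 1); [by apply: eigZ; rewrite expf_neq0 | | by right].
rewrite !exprZn -!exprM F4_exp4 // -[(2 * 3)%N]/(3 * 2)%N exprM F4_cube //.
by rewrite expr1n !scale1r scale0r A3 b0 scale0r.
Qed.

End F4.

(** * The groups M20 and M21 *)

Section MorphismTriples.

Local Open Scope group_scope.

Variables (gT rT : finGroupType) (D : {group gT}) (f : {morphism D >-> rT}).
Variables x t : gT.

Hypotheses (Dx : x \in D) (Dt : t \in D).

Lemma morph_commuteJ : commute x (x ^ t) -> commute (f x) (f x ^ f t).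
Proof. by move=> xt; rewrite -morphJ // /commute -!morphM ?groupJ // xt. Qed.

Lemma morph_tripleJ : (x * x ^ t * x ^ (t ^+ 2) = 1)%g ->
  (f x * f x ^ f t * f x ^ (f t ^+ 2) = 1)%g.
Proof.
move=> xtt; have Dxt : x ^ t \in D by rewrite groupJ.
have Dxtt : x ^ (t ^+ 2) \in D by rewrite groupJ ?groupX.
by rewrite -morphX // -!morphJ ?groupX // -!morphM ?(groupM Dx Dxt) // xtt morph1.
Qed.

End MorphismTriples.

Section Mathieu.

Local Open Scope ring_scope.

Variables (k : closedFieldType) (F : finFieldType).
Hypotheses (char0 : [pchar k] =i pred0) (hF : #|F| = 4%N).

Local Notation Z := ('Z(SL3 F)%g).
Local Notation proj := (coset Z).

Lemma SL3_of_mx (T : 'M[F]_3) : \det T = 1 ->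
  exists2 t : {'GL_3[F]}, t \in SL3 F & GLval t = T.
Proof.
move=> dT; have uT : T \in unitmx by rewrite unitmxE dT unitr1.
by exists (FinRing.unit _ uT : {'GL_3[F]}); rewrite ?inE /= ?dT.
Qed.

Lemma SL3_norm (A : {'GL_3[F]}) : A \in SL3 F -> A \in 'N(Z)%g.
Proof. exact: (subsetP (normal_norm (center_normal (SL3_group F)))). Qed.

(** All nonzero elements of the field with four elements have cube 1, so that
    the scalar matrices belong to the centre of SL3. *)
Lemma SL3_scale (A : {'GL_3[F]}) m : A \in SL3 F -> m != 0 ->
  exists2 B : {'GL_3[F]}, B \in SL3 F /\ proj B = proj A & GLval B = m *: GLval A.
Proof.
move=> SA nzm; have dA : \det (GLval A) = 1 by move: SA; rewrite inE => /eqP.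
have m3 := F4_cube hF nzm.
have [B SB BE] : exists2 B : {'GL_3[F]}, B \in SL3 F & GLval B = m *: GLval A.
  by apply: SL3_of_mx; rewrite detZ dA mulr1 m3.
have [z Sz zE] : exists2 z : {'GL_3[F]}, z \in SL3 F & GLval z = m%:M.
  by apply: SL3_of_mx; rewrite det_scalar m3.
exists B => //; split=> //.
have -> : B = (A * z)%g.
  by apply: val_inj; rewrite /= -[val B]/(GLval B) BE -[val z]/(GLval z) zE
     -[_ * _]/(GLval A *m m%:M) mul_mx_scalar.
have Zz : z \in 'Z(SL3 F)%g.
  apply/centerP; split=> // y _; apply: val_inj; rewrite /= -[val z]/(GLval z) zE.
  by rewrite -[LHS]/(m%:M *m GLval y) -[RHS]/(GLval y *m m%:M) scalar_mxC.
exact: (@coset_kerr _ 'Z(SL3 F)%G).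
Qed.

Lemma class_typeB_tamed (G : {group coset_of Z}) (A t : {'GL_3[F]}) :
  A \in SL3 F -> t \in SL3 F -> proj A \in G -> proj t \in G ->
  tamed (GLval A) (GLval t) -> class_typeB k G (proj A).
Proof.
move=> SA St GA Gt; have NA := SL3_norm SA; have Nt := SL3_norm St.
have expE n : GLval A ^+ n = 1 -> (proj A ^+ n = 1)%g.
  move=> An; rewrite -morphX //; have -> : (A ^+ n = 1)%g.
    by apply: val_inj; rewrite FinRing.val_unitX.
  exact: (coset_id (group1 'Z(SL3 F)%G)).
have conjE (X Y : {'GL_3[F]}) (M : 'M[F]_3) :
    GLval X * GLval Y = GLval Y * M -> GLval (X ^ Y)%g = M.
  move=> XY; apply: (mulrI (GL_unit Y)); rewrite -XY -!GL_ME.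
  by rewrite -conjgC.
case=> [[inv A15] | [[A1 [A2 [h1 h2 h3 h4]]] A28]].
  apply: (class_typeB_real char0 GA Gt).
    rewrite -morphJ // -morphV //; congr (proj _); apply: val_inj.
    rewrite -[LHS]/(GLval (A ^ t)%g) -[RHS]/(GLval A^-1%g); apply: conjE.
    by rewrite -[in RHS]inv GL_VE mulrK ?GL_unit.
  by apply: (@dvdn_odd _ 15) => //; rewrite order_dvdn expE.
have At : GLval (A ^ t)%g = A1 by apply: conjE.
have At2 : GLval (A ^ (t ^+ 2))%g = A2.
  by rewrite expgS expg1 conjgM; apply: conjE; rewrite At.
apply: (class_typeB_triple char0 GA Gt).
- apply: (@morph_commuteJ _ _ _ (coset_morphism Z) _ _ NA Nt); apply: val_inj.
  by rewrite -[LHS]/(GLval A * GLval (A ^ t)%g)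
     -[RHS]/(GLval (A ^ t)%g * GLval A) At h4.
- apply: (@morph_tripleJ _ _ _ (coset_morphism Z) _ _ NA Nt); apply: val_inj.
  by rewrite -[LHS]/(GLval A * GLval (A ^ t)%g *
     GLval (A ^ (t ^+ 2))%g) At At2 h3.
have d28 : (#[proj A]%g %| 28)%N by rewrite order_dvdn expE.
exact: coprime_dvdl d28 _.
Qed.

Definition line (p : 'rV[F]_3) : {set 'rV[F]_3} := [set a *: p | a : F].

Lemma line_stable (p : 'rV[F]_3) (A : 'M[F]_3) s : s != 0 -> p *m A = s *: p ->
  [set v *m A | v in line p] = line p.
Proof.
move=> nzs pA; apply/setP=> v; apply/imsetP/imsetP.
  case=> _ /imsetP[a _ ->] ->; exists (a * s) => //.
  by rewrite -scalemxAl pA scalerA.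
case=> a _ ->; exists ((a / s) *: p); first by apply/imsetP; exists (a / s).
by rewrite -scalemxAl pA scalerA divfK.
Qed.

Lemma M20P (p : 'rV[F]_3) (A : {'GL_3[F]}) : p != 0 -> A \in SL3 F ->
  reflect (exists2 s, s != 0 & p *m GLval A = s *: p)
          (proj A \in M20 (line p)).
Proof.
move=> nzp SA; have Pp : line p \in points F by apply/imsetP; exists p; rewrite ?inE.
have GA : proj A \in (PSL3 F : {set _}) by apply: (mem_quotient 'Z(SL3 F)%G).
have -> : (proj A \in M20 (line p)) = (point_action F (line p) (proj A) == line p).
  have DA : proj A \in ('GL_3[F]%G / 'Z(SL3 F)%G)%g.
    by apply: mem_quotient; rewrite inE.
  rewrite /M20 /= in_setI GA /= /astab !inE DA /= sub1set inE; exact: erefl.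
rewrite point_actionE //; apply: (iffP eqP) => [lE | [s nzs pA]]; last first.
  exact: line_stable pA.
have : p *m GLval A \in line p.
  by rewrite -lE; apply: imset_f; apply/imsetP; exists 1; rewrite ?scale1r.
case/imsetP=> s _ pA; exists s => //; apply: contraNneq nzp => s0.
have : p *m GLval A *m invmx (GLval A) = 0 by rewrite pA s0 scale0r mul0mx.
by rewrite mulmxK ?GL_unitmx // => ->.
Qed.

(** After scaling A so that it fixes p, the conjugating matrix can be chosen to
    preserve the line of p: it then lies in the stabilizer of this line. *)
Lemma class_typeB_fixed (G : {group coset_of Z}) (p : 'rV[F]_3)
    (A : {'GL_3[F]}) s :
  p != 0 -> s != 0 -> A \in SL3 F -> p *m GLval A = s *: p ->
  proj A \in G -> M20 (line p) \subset G -> class_typeB k G (proj A).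
Proof.
move=> nzp nzs SA pA GA sG.
have nzV : s^-1 != 0 by rewrite invr_eq0.
have [B [SB <-] BE] := SL3_scale SA nzV.
have pB : p *m GLval B = p by rewrite BE -scalemxAr pA scalerA mulVf // scale1r.
have dB : \det (GLval B) = 1 by move: SB; rewrite inE => /eqP.
have [T [dT [r nzr pT] tB]] := tamed_of_fixed hF dB nzp pB.
have [t St tE] := SL3_of_mx dT; rewrite -tE in pT tB.
apply: class_typeB_tamed tB => //; last first.
  by apply: (subsetP sG); apply/(M20P nzp St); exists r.
by apply: (subsetP sG); apply/(M20P nzp SB); exists 1; rewrite ?oner_neq0 ?scale1r.
Qed.

Lemma PSL3_lift g : g \in (PSL3 F : {set _}) -> exists2 A, A \in SL3 F & g = proj A.
Proof. by case/morphimP=> A _ SA ->; exists A. Qed.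

Lemma M20_typeB P : P \in points F -> group_typeB k (M20 P).
Proof.
case/imsetP=> p; rewrite inE => nzp -> g Gg.
have [A SA gE] : exists2 A, A \in SL3 F & g = proj A.
  by apply: PSL3_lift; case/setIP: Gg.
rewrite gE in Gg *; have [s nzs pA] := M20P nzp SA Gg.
exact: class_typeB_fixed pA Gg _.
Qed.

Lemma M21_typeB : group_typeB k (M21 F).
Proof.
move=> g Gg; have [A SA gE] := PSL3_lift Gg; rewrite gE in Gg *.
have dA : \det (GLval A) = 1 by move: SA; rewrite inE => /eqP.
have [[s /eigenvalueP[p pA nzp]] | noeig] :
    (exists s, eigenvalue (GLval A) s) \/ forall s, ~~ eigenvalue (GLval A) s.
- case: (boolP [exists s, eigenvalue (GLval A) s]) => [/existsP|].
    by left.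
  by rewrite negb_exists => /forallP; right.
- have nzs : s != 0.
    apply: contraNneq nzp => s0.
    have : p *m GLval A *m invmx (GLval A) = 0 by rewrite pA s0 scale0r mul0mx.
    by rewrite mulmxK ?GL_unitmx // => ->.
  by apply: (class_typeB_fixed nzp nzs SA pA Gg); apply: subsetIl.
have [m nzm [T dT tA]] := tamed_of_irreducible hF dA noeig.
have [B [SB BA] BE] := SL3_scale SA nzm.
have [t St tE] := SL3_of_mx dT; rewrite -BE -tE in tA; rewrite -BA in Gg *.
by apply: class_typeB_tamed tA => //; apply: (mem_quotient 'Z(SL3 F)%G).
Qed.

End Mathieu.

Theorem theorem1p4 (k : closedFieldType) (hk : [pchar k]%R =i pred0)
    (F : finFieldType) (hF : #|F| = 4) :
  (forall P : {set 'rV[F]_3}, P \in points F -> group_typeB k (M20 P)) /\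
  group_typeB k (M21 F).
Proof.
by split; [move=> P; apply: M20_typeB | apply: M21_typeB].
Qed.
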